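(* Let $F_\infty$ be the canonical one-sided graph of a nested fractal, with root $O$, walk counts $c_n$, $u_n$ and maximal degree $D$ as defined in the context. Then the limits of $c_n^{1/n}$ and $u_n^{1/n}$ exist and are equal, and $$\mu:=\lim_{n\to\infty}c_n^{1/n}=\lim_{n\to\infty}u_n^{1/n}=\inf_{n\ge1}u_n^{1/n}.$$ Moreover, $$1\le\mu\le D-1<\infty.$$
   Context: **Nested fractal.** Fix $d\ge1$, $M\ge2$, $\mathcal I=\{0,\dots,M-1\}$, $\lambda>1$, and contractive similitudes $\Psi_i(x)=\lambda^{-1}U_ix+\nu_i$ of $\mathbb R^d$ ($i\in\mathcal I$) with $U_i$ orthogonal. $K$ is the unique nonempty compact set with $K=\bigcup_{i}\Psi_i(K)$. Let $p_i$ be the fixed point of $\Psi_i$; $p_i$ is essential if there are a fixed point $p_j$ and distinct $k,\ell\in\mathcal I$ with $\Psi_k(p_i)=\Psi_\ell(p_j)$. $V_0=\{q_0,\dots,q_{b-1}\}$ is the set of essential fixed points, $b=\#V_0\ge2$. For a word $w=w_1\cdots w_r\in\mathcal I^r$, $\Psi_w=\Psi_{w_1}\circ\cdots\circ\Psi_{w_r}$ ($\Psi_\emptyset=\mathrm{id}$), $|w|=r$, $K_w=\Psi_w(K)$ is a level-$r$ fractal cell and $\partial K_w=\Psi_w(V_0)$ its boundary. For distinct $x,y\in V_0$, $\mathscr R_{x,y}$ is the reflection in the hyperplane $\{z:|z-x|=|z-y|\}$. $K$ is a nested fractal if: (NF1) there is a nonempty bounded open set $\mathcal U$ with $\Psi_i(\mathcal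 U)\cap\Psi_j(\mathcal U)=\varnothing$ for $i\ne j$ and $\bigcup_i\Psi_i(\mathcal U)\subset\mathcal U$; (NF2) $K$ is connected; (NF3) for all distinct $x,y\in V_0$, $\mathscr R_{x,y}$ preserves $V_0$ and, for each $r\ge1$, permutes the level-$r$ fractal cells together with their boundaries; (NF4) for distinct $i,j\in\mathcal I$, $\Psi_i(K)\cap\Psi_j(K)=\Psi_i(V_0)\cap\Psi_j(V_0)$. Standing assumption (one-point intersection): $\#(\Psi_u(V_0)\cap\Psi_v(V_0))\le1$ whenever $u\ne v$, $|u|=|v|$. **Graphs.** $\delta_0=\min\{|x-y|:x\neq y\in V_0\}$; $F_0$ is the graph on $V_0$ with edges $\{x,y\}$ with $|x-y|=\delta_0$. Choose $O\in V_0$ and label the maps so that $\Psi_0(O)=O$. Put $F_m=\bigcup_{w\in\mathcal I^m}(\Psi_0^{-m}\circ\Psi_w)(F_0)$ (union of image graphs; $\Psi_0^{-m}$ is the $m$-fold inverse iterate), $F_\infty=\bigcup_{m\ge0}F_m$, $V_\infty=V(F_\infty)$. **Walks.** A walk of length $n$ is a sequence $(w(0),\dots,w(n))$ of vertices of $F_\infty$ with consecutive vertices adjacent; it is self-avoiding if its vertices are distinct. $c_{a,n}$ is the number of self-avoiding walks of length $n$ starting at $a\in V_\infty$, $c_n=c_{O,n}$, $u_n=\sup_{a\in V_\infty}c_{a,n}$, $c_{a,0}=c_0=u_0=1$, and $D=\sup_{x\in V_\infty}\deg_{F_\infty}(x)$. *)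

(* Defs.v *)
From HB Require Import structures.
From mathcomp Require Import all_boot all_order all_algebra perm.
From mathcomp Require Import all_classical all_reals all_analysis.

Set Implicit Arguments.
Unset Strict Implicit.
Unset Printing Implicit Defensive.

Import Order.TTheory GRing.Theory Num.Theory.
Import numFieldNormedType.Exports.

Local Open Scope classical_set_scope.
Local Open Scope card_scope.
Local Open Scope ring_scope.

(* R^d is 'cV[R]_d. The library norm on it is the sup norm: it has the same
   open, compact and bounded sets as the Euclidean norm, but distances have to
   be measured with enorm. *)
Definition dotv (R : realType) (d : nat) (x y : 'cV[R]_d) : R :=
  \sum_(k < d) x k ord0 * y k ord0.

Definition enorm (R : realType) (d : nat) (x : 'cV[R]_d) : R :=
  Num.sqrt (dotv x x).

Record similitudes (R : realType) (d M : nat) := Similitudes {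
  ratio : R;
  rot : 'I_M -> 'M[R]_d;
  shift : 'I_M -> 'cV[R]_d;
  ratio_gt1 : 1 < ratio;
  rot_orthogonal : forall i, (rot i)^T *m rot i = 1%:M }.

Section IFS.
Context {R : realType} {d M : nat}.
Variable S : similitudes R d M.
Local Notation E := 'cV[R]_d.

Definition Psi (i : 'I_M) (x : E) : E :=
  (ratio S)^-1 *: (rot S i *m x) + shift S i.

Definition Psi_inv (i : 'I_M) (y : E) : E :=
  ratio S *: (invmx (rot S i) *m (y - shift S i)).

Lemma PsiK i : cancel (Psi i) (Psi_inv i).
Proof.
move=> x; have l0 : ratio S != 0 by rewrite gt_eqF ?(lt_trans _ (ratio_gt1 S)).
rewrite /Psi_inv /Psi addrK -scalemxAr scalerA mulfV // scale1r mulKmx //.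
by have [] := mulmx1_unit (rot_orthogonal S i).
Qed.

Lemma Psi_invK i : cancel (Psi_inv i) (Psi i).
Proof.
move=> y; have l0 : ratio S != 0 by rewrite gt_eqF ?(lt_trans _ (ratio_gt1 S)).
rewrite /Psi_inv /Psi -scalemxAr scalerA mulVf // scale1r mulKVmx ?subrK //.
by have [] := mulmx1_unit (rot_orthogonal S i).
Qed.

(* Psi_w for w = w_1 ... w_r is Psi_(w_1) \o ... \o Psi_(w_r) *)
Definition Psiw (w : seq 'I_M) (x : E) : E := foldr Psi x w.

(* The nonempty compact set with this property is unique (Hutchinson). *)
Definition attractor (K : set E) : Prop :=
  [/\ K !=set0, compact K & K = \bigcup_(i in [set: 'I_M]) (Psi i @` K)].

Definition fixed_points : set E := [set p | exists i, Psi i p = p].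

(* V_0, the set of essential fixed points *)
Definition V0 : set E := [set p | fixed_points p /\
  exists q k l, [/\ fixed_points q, k <> l & Psi k p = Psi l q]].

Definition cell (K : set E) (w : seq 'I_M) : set E := Psiw w @` K.

Definition cell_boundary (w : seq 'I_M) : set E := Psiw w @` V0.

(* For x != y, the reflection in the hyperplane [set z | |z - x| = |z - y|],
   which passes through the midpoint of x and y with normal vector x - y *)
Definition reflection (x y z : E) : E :=
  z - (2 * dotv (z - 2^-1 *: (x + y)) (x - y) / dotv (x - y) (x - y))
        *: (x - y).

Definition open_set_condition : Prop := exists U : set E,
  [/\ U !=set0, bounded_set U, open U,
      forall i j, i <> j -> (Psi i @` U) `&` (Psi j @` U) = set0
    & \bigcup_(i in [set: 'I_M]) (Psi i @` U) `<=` U].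

Definition symmetry (K : set E) : Prop :=
  forall x y, V0 x -> V0 y -> x <> y ->
    reflection x y @` V0 = V0 /\
    forall r, (1 <= r)%N -> exists s : {perm r.-tuple 'I_M},
      forall w : r.-tuple 'I_M,
        reflection x y @` cell K w = cell K (s w) /\
        reflection x y @` cell_boundary w = cell_boundary (s w).

Definition nesting (K : set E) : Prop :=
  forall i j, i <> j ->
    (Psi i @` K) `&` (Psi j @` K) = (Psi i @` V0) `&` (Psi j @` V0).

Definition nested_fractal (K : set E) : Prop :=
  [/\ attractor K,
      `I_2 #<= V0,
      open_set_condition,
      connected K
    & symmetry K /\ nesting K].

Definition one_point_intersection : Prop :=
  forall u v : seq 'I_M, u <> v -> size u = size v ->
    cell_boundary u `&` cell_boundary v #<= `I_1.

End IFS.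

Record graph (T : Type) := Graph {
  vertices : set T;
  adj : T -> T -> Prop }.

Definition image_graph (T U : Type) (f : T -> U) (G : graph T) : graph U :=
  Graph (f @` vertices G)
    (fun u v => exists x y, [/\ adj G x y, f x = u & f y = v]).

Definition bigcup_graph (I T : Type) (G : I -> graph T) : graph T :=
  Graph (\bigcup_(i in [set: I]) vertices (G i))
    (fun x y => exists i, adj (G i) x y).

Section FractalGraph.
Context {R : realType} {d M : nat}.
Variable S : similitudes R d M.
Local Notation E := 'cV[R]_d.

(* a minimum, V0 S being finite with at least two points *)
Definition delta0 : R :=
  inf [set enorm (p.1 - p.2) | p in
        [set p : E * E | [/\ V0 S p.1, V0 S p.2 & p.1 <> p.2]]].

Definition F0 : graph E :=
  Graph (V0 S)
    (fun x y => [/\ V0 S x, V0 S y, x <> y & enorm (x - y) = delta0]).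

(* i0 is the label, 0 by convention, of the map that fixes the root *)
Definition F (i0 : 'I_M) (m : nat) : graph E :=
  bigcup_graph (fun w : m.-tuple 'I_M =>
    image_graph (iter m (Psi_inv S i0) \o Psiw S w) F0).

Definition Finfty (i0 : 'I_M) : graph E := bigcup_graph (F i0).

End FractalGraph.

(* Numbers of walks, degrees and their suprema are extended reals: `counting`
   is the cardinality, +oo for an infinite set, so that no finiteness is
   presupposed. *)
Section Walks.
Context (R : realType) {T : choiceType}.
Variable G : graph T.

Definition degree (x : T) : \bar R := counting [set y | adj G x y].

Definition max_degree : \bar R := ereal_sup [set degree x | x in vertices G].

Definition walk (n : nat) (w : n.+1.-tuple T) : Prop :=
  (forall k, vertices G (tnth w k)) /\ sorted (fun x y => `[< adj G x y >]) w.

Definition self_avoiding_walk (n : nat) (w : n.+1.-tuple T) : Prop :=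
  walk w /\ uniq w.

Definition saw_count (a : T) (n : nat) : \bar R :=
  counting [set w : n.+1.-tuple T | self_avoiding_walk w /\ thead w = a].

Definition saw_sup (n : nat) : \bar R :=
  ereal_sup [set saw_count a n | a in vertices G].

End Walks.

(* Main.v *)
Require Import Defs.
From HB Require Import structures.
From mathcomp Require Import all_boot all_order all_algebra perm.
From mathcomp Require Import all_classical all_reals all_analysis.
From mathcomp Require Import zify ring lra.
Import Order.TTheory GRing.Theory Num.Theory.
Import numFieldNormedType.Exports.
Local Open Scope classical_set_scope.
Local Open Scope ring_scope.

Set Implicit Arguments.
Unset Strict Implicit.
Unset Printing Implicit Defensive.

(* The sequence u_n is submultiplicative, so u_n^(1/n) tends to its infimum mu, and
   u_n <= C (mu (1 + delta))^n. What remains is that c_n is not much smaller than mu^n.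

   Call k-vertices the corners of the level-k cells of the infinite graph, let rho_k be
   the distance of two distinct k-vertices and g_k the radius of a level-k cell seen
   from a corner. Given a large n, take k with g_k much smaller than n and K = k + s with
   n <= rho_K; then s is bounded independently of n, because
   - g_k is at most a constant times rho_k. A path from x to another corner y of a
     cell, folded along the bisector of y and z, becomes a path from x to z, for z a
     nearest neighbour of x; so nearest neighbours realize rho_k. An edge cannot jump
     over the mirror, since this would give a corner of K separating other corners;
   - rho_(k+s) >= c lambda^s rho_k, by comparison with the Euclidean distance.
   Since a level-K cell has a bounded number of k-vertices, a walk of length 2nJ, for a
   suitable constant J, contains one of the following:
   - n steps that start at a K-vertex and meet no other one. They stay in one cell, and a
     reflection moves their starting point to O: there are at most N c_n of them, where
     N bounds the number of cells at a point (by packing, from the open set condition);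
   - 2n steps inside a level-k cell. In a copy of that cell at O, join O to the walk by a
     path of length at most g_k and follow the longer part of the walk: n steps of it
     are counted by c_(n + g_k) <= c_n D^(g_k), the others by u_i u_(n - i).
   Hence mu^(2nJ) <= u_(2nJ) <= c_n mu^(2nJ - n) exp(o(n)). *)

(** * Counting walks *)

Section LeCard.
Local Open Scope nat_scope.

(** Stated with duplicate-free lists, so that it makes sense before [P] is known to be finite;
    finiteness follows in [le_card_enum]. *)
Definition le_card (X : eqType) (P : X -> Prop) (N : nat) : Prop :=
  forall s : seq X, uniq s -> (forall x, x \in s -> P x) -> size s <= N.

Lemma le_card_sub (X : eqType) (P Q : X -> Prop) N :
  (forall x, P x -> Q x) -> le_card Q N -> le_card P N.
Proof. by move=> PQ QN s us sP; apply: QN => // x /sP /PQ. Qed.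

Lemma le_card_leq (X : eqType) (P : X -> Prop) M N :
  M <= N -> le_card P M -> le_card P N.
Proof. by move=> MN PM s us /(PM s us) /leq_trans; apply. Qed.

Lemma le_card_inj (X Y : eqType) (f : X -> Y) (P : X -> Prop) (Q : Y -> Prop) N :
  (forall x y, P x -> P y -> f x = f y -> x = y) ->
  (forall x, P x -> Q (f x)) -> le_card Q N -> le_card P N.
Proof.
move=> finj PQ QN s us sP; rewrite -(size_map f); apply: QN.
  by rewrite map_inj_in_uniq // => x y /sP Px /sP Py; apply: finj.
by move=> _ /mapP[x /sP /PQ ? ->].
Qed.

(** Counting by fibres: choose one related [y] for each [x]. At most [M] values occur, with at most
    [N] elements over each. *)
Lemma le_card_rel (X Y : eqType) (Rel : X -> Y -> Prop) (P : X -> Prop)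
    (Q : Y -> Prop) M N :
  (forall x, P x -> exists2 y, Q y & Rel x y) -> le_card Q M ->
  (forall y, Q y -> le_card (fun x => P x /\ Rel x y) N) -> le_card P (M * N).
Proof.
move=> PQ QM QN s us sP.
have [->//|[x0 x0s]] : s = [::] \/ exists x0, x0 \in s.
  by case: (s) => [|x0 s']; [left|right; exists x0; rewrite mem_head].
have [y0 _ _] := PQ _ (sP _ x0s).
have /choice[f fP] : forall x, exists y, x \in s -> Q y /\ Rel x y.
  move=> x; have [xs|_] := boolP (x \in s); last by exists y0.
  by have [y Qy xy] := PQ _ (sP _ xs); exists y.
pose t := undup (map f s).
have tQ y : y \in t -> Q y.
  by rewrite mem_undup => /mapP[x xs ->]; have [] := fP _ xs.
have st : {subset s <= flatten [seq [seq x <- s | f x == y] | y <- t]}.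
  move=> x xs; apply/flatten_mapP; exists (f x); first by rewrite mem_undup map_f.
  by rewrite mem_filter eqxx.
apply: leq_trans (uniq_leq_size us st) _.
rewrite size_flatten /shape -map_comp.
have : size t <= M by apply: QM; rewrite ?undup_uniq.
move=> tM; apply: (@leq_trans (size t * N)); last by rewrite leq_mul2r tM orbT.
elim: t tQ {st tM} => //= y t IH tQ; rewrite mulSn leq_add //; last first.
  by apply: IH => z zt; apply: tQ; rewrite in_cons zt orbT.
apply: (QN y); [exact/tQ/mem_head|exact: filter_uniq|] => x.
by rewrite mem_filter => /andP[/eqP <- xs]; have [] := fP _ xs; split=> //; apply: sP.
Qed.

Lemma le_card_bigcup (X : eqType) (Pi : nat -> X -> Prop) (P : X -> Prop)
    (n : nat) (N : nat -> nat) :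
  (forall x, P x -> exists2 i, i < n & Pi i x) ->
  (forall i, i < n -> le_card (Pi i) (N i)) ->
  le_card P (\sum_(i < n) N i).
Proof.
move=> PPi PiN s us sP.
have st : {subset s <= flatten [seq [seq x <- s | `[< Pi i x >]] | i <- iota 0 n]}.
  move=> x xs; have [i ltin Pix] := PPi _ (sP _ xs); apply/flatten_mapP.
  exists i; first by rewrite mem_iota.
  by rewrite mem_filter xs andbT; apply/asboolP.
apply: leq_trans (uniq_leq_size us st) _.
rewrite size_flatten /shape -map_comp sumnE big_map -(big_mkord xpredT N).
rewrite /index_iota subn0 big_seq [leqRHS]big_seq.
apply: leq_sum => i; rewrite mem_iota => /PiN; apply; first exact: filter_uniq.
by move=> x; rewrite mem_filter => /andP[/asboolP].
Qed.

Lemma le_card_or (X : eqType) (P Q : X -> Prop) M N :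
  le_card P M -> le_card Q N -> le_card (fun x => P x \/ Q x) (M + N).
Proof.
move=> PM QN s us sP; rewrite -(count_predC (fun x => `[< P x >])) -!size_filter.
apply: leq_add; [apply: PM|apply: QN]; rewrite ?filter_uniq// => x;
  rewrite mem_filter => /andP[/asboolP]// nP /sP[]//.
Qed.

(** A duplicate-free list in [P] of maximal length must contain all of [P]. *)
Lemma le_card_enum (X : eqType) (P : X -> Prop) N : le_card P N ->
  exists s, [/\ uniq s, forall x, x \in s <-> P x & size s <= N].
Proof.
move=> PN.
pose A k := `[< exists s : seq X, [/\ uniq s, forall x, x \in s -> P x & size s = k] >].
have A0 : exists k, A k by exists 0; apply/asboolP; exists [::].
have AN k : A k -> k <= N by move=> /asboolP[s [us sP <-]]; apply: PN.
case: (ex_maxnP A0 AN) => k /asboolP[s [us sP sk]] kmax.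
exists s; split=> // [x|]; last exact: PN.
split=> [/sP//|Px]; apply: contrapT => /negP xs.
suff : A k.+1 by move=> /kmax; rewrite ltnn.
apply/asboolP; exists (x :: s); rewrite /= xs us sk; split=> // y.
by rewrite in_cons => /orP[/eqP->//|/sP].
Qed.
End LeCard.

(** * Self-avoiding walks and their concatenation *)

Section SAW.
Local Open Scope nat_scope.
Variables (T : choiceType) (e : rel T).

(** The start [a] is kept apart from the list [p], whose size is thus the number of steps. *)
Definition saw (a : T) (n : nat) (p : seq T) : Prop :=
  [/\ size p = n, path e a p & uniq (a :: p)].

Lemma saw_take a n p i : i <= n -> saw a n p -> saw a i (take i p).
Proof.
move=> ilen [sp ep up]; split; first by rewrite size_takel ?sp.
  by move: ep; rewrite -{1}(cat_take_drop i p) cat_path => /andP[].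
by move: up; rewrite -{1}(cat_take_drop i p) -cat_cons cat_uniq => /andP[].
Qed.

Lemma saw_drop a n p i : i <= n -> saw a n p ->
  saw (last a (take i p)) (n - i) (drop i p).
Proof.
move=> ilen [sp ep up]; split; first by rewrite size_drop sp.
  by move: ep; rewrite -{1}(cat_take_drop i p) cat_path => /andP[].
move: up; rewrite -{1}(cat_take_drop i p) -cat_cons lastI cat_rcons.
by rewrite cat_uniq => /and3P[].
Qed.

Lemma path_last (V : T -> Prop) a p : (forall x y, e x y -> V y) ->
  V a -> path e a p -> V (last a p).
Proof.
by move=> eV; elim: p a => //= b p IH a _ /andP[/eV /IH].
Qed.

(** A walk is determined by its consecutive pieces of lengths [i], [n] and [r], each a self-avoiding
    walk from the end of the one before; [Q] constrains the middle piece only. *)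
Lemma le_card_saw_block (V : T -> Prop) (Q : T -> seq T -> Prop) a i n r A B C :
  (forall x y, e x y -> V y) -> V a ->
  le_card (saw a i) A ->
  (forall b, V b -> le_card (fun p => saw b n p /\ Q b p) B) ->
  (forall b, V b -> le_card (saw b r) C) ->
  le_card (fun p => saw a (i + n + r) p /\ Q (last a (take i p)) (take n (drop i p)))
    (A * B * C).
Proof.
move=> eV Va cA cB cC; rewrite -mulnA.
apply: (@le_card_rel _ _ (fun p p1 => take i p = p1) _ (saw a i)) => //.
  by move=> p [sp _]; exists (take i p) => //; apply: saw_take sp; lia.
move=> p1 [sp1 ep1 up1]; have Vb := path_last eV Va ep1.
apply: (@le_card_rel _ _ (fun p p2 => take n (drop i p) = p2) _
          (fun p2 => saw (last a p1) n p2 /\ Q (last a p1) p2)); last 2 first.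
- exact: cB.
- move=> p2 [[sp2 ep2 up2] _]; have Vc := path_last eV Vb ep2.
  apply: (le_card_inj (f := drop (i + n)) _ _ (cC _ Vc)).
    move=> p p' [[_ t1] t2] [[_ t1'] t2'] dE.
    rewrite -(cat_take_drop (i + n) p) -[RHS](cat_take_drop (i + n) p') dE.
    by rewrite !takeD t1 t2 t1' t2'.
  move=> p [[[sp _] t1] t2]; have := saw_drop (leq_addr r (i + n)) sp.
  by rewrite addKn takeD last_cat t1 t2.
move=> p [[sp Qp] t1]; exists (take n (drop i p)) => //; rewrite -t1; split=> //.
have h : i <= i + n + r by lia.
by have := saw_take (_ : n <= _) (saw_drop h sp); apply; lia.
Qed.

Lemma le_card_saw0 a : le_card (saw a 0) 1.
Proof.
move=> [|x [|y s]] // /andP[]; rewrite inE negb_or => /andP[/eqP xy _ _] sP.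
have [/size0nil x0 _ _] := sP x (mem_head _ _).
have [|/size0nil y0 _ _] := sP y; first by rewrite !inE eqxx orbT.
by rewrite x0 y0 in xy.
Qed.

Lemma le_card_saw1 a D : le_card (fun y => e a y) D -> le_card (saw a 1) D.
Proof.
apply: (le_card_inj (f := head a)).
  by move=> [|x [|? ?]] [|y [|? ?]] [] // _ _ _ [] //= _ _ _ ->.
by move=> [|x [|? ?]] [] //= _; rewrite andbT.
Qed.

Lemma le_card_sawD (V : T -> Prop) a m n A B :
  (forall x y, e x y -> V y) -> V a ->
  le_card (saw a m) A -> (forall b, V b -> le_card (saw b n) B) ->
  le_card (saw a (m + n)) (A * B).
Proof.
move=> eV Va cA cB.
rewrite -(addn0 m) -[A * B]/(A * B) -(muln1 A).
suff H b : V b -> le_card (fun p => saw b 0 p /\ True) 1.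
  by apply: le_card_sub (le_card_saw_block (Q := fun _ _ => True) eV Va cA H cB).
by move=> _; apply: (@le_card_sub _ _ (saw b 0)) => [p []//|]; apply: le_card_saw0.
Qed.

Lemma le_card_saw_exp (V : T -> Prop) D : (forall x y, e x y -> V y) ->
  (forall x, V x -> le_card (fun y => e x y) D) ->
  forall n a, V a -> le_card (saw a n) (D ^ n).
Proof.
move=> eV deg; elim=> [|n IH] a Va; first exact: le_card_saw0.
rewrite -add1n expnD expn1; apply: (le_card_sawD eV Va) => //.
exact/le_card_saw1/deg.
Qed.
End SAW.

Section CellCounting.
Local Open Scope nat_scope.
Variables (T : choiceType) (e : rel T) (V : T -> Prop) (O : T).
Hypothesis e_sym : symmetric e.
Hypothesis eV : forall x y, e x y -> V y.
Hypothesis VO : V O.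
Variables u c : nat -> nat.
Hypothesis hu : forall a n, V a -> le_card (saw e a n) (u n).
Hypothesis hc : forall n, le_card (saw e O n) (c n).

Definition reach (x y : T) (r : nat) : Prop :=
  exists p, [/\ path e x p, last x p = y & size p <= r].

(** Take a shortest path from [x] into [w] and remove its loops: an earlier vertex in [w] would give
    a shorter path. *)
Lemma first_hit (w : {pred T}) x p : path e x p -> last x p \in w ->
  exists p', [/\ path e x p', uniq (x :: p'), last x p' \in w,
    forall y, y \in belast x p' -> y \notin w & size p' <= size p].
Proof.
move=> ep lw.
pose A n := `[< exists q, [/\ path e x q, last x q \in w & size q = n] >].
have A1 : exists n, A n by exists (size p); apply/asboolP; exists p.
case: (ex_minnP A1) => n /asboolP[q [eq lq sq]] nmin.
have pn : n <= size p by apply: nmin; apply/asboolP; exists p.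
move: lq sq; case/shortenP: eq => q' eq' uq' sub lq' sq.
have sz : size q' <= n by rewrite -sq; apply: uniq_leq_size => //; case/andP: uq'.
exists q'; split=> //; last exact: leq_trans pn.
move=> y yq; apply/negP => yw.
have : y \in x :: q' by rewrite lastI mem_rcons in_cons yq orbT.
case/splitPl E : _ / => [q1 q2 l1].
have : n <= size q1.
  apply: nmin; apply/asboolP; exists q1; split=> //; last by rewrite l1.
  by move: eq'; rewrite E cat_path => /andP[].
move: sz; rewrite E size_cat => h1 h2; have /size0nil q20 : size q2 = 0 by lia.
move: uq'; rewrite lastI rcons_uniq => /andP[/negP[]].
by rewrite E q20 cats0 l1; move: yq; rewrite E q20 cats0.
Qed.

Definition near_walk (g : nat) (w : seq T) : Prop :=
  [/\ sorted e w, uniq w & forall x, x \in w -> reach O x g].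

(* A path from O that first meets the walk at time i is continued along the walk for
   n more steps. The result is one of c (h + n) walks; the rest of the walk consists
   of two walks, of lengths i and n - i. *)
Lemma le_card_hit n i h : i <= n ->
  le_card (fun w => [/\ size w = n.*2.+1, sorted e w, uniq w &
      exists p, [/\ size p = h, path e O p, uniq (O :: p), last O p = nth O w i &
                    forall y, y \in belast O p -> y \notin w]])
    (c (h + n) * (u i * u (n - i))).
Proof.
move=> ilen.
pose Rel w y := exists p, [/\ size p = h, path e O p, last O p = nth O w i & y = p ++ take n (drop i.+1 w)].
apply: (@le_card_rel _ _ Rel _ (saw e O (h + n))) => //.
  move=> w [sw ew uw [p [sp ep up lp bp]]].
  exists (p ++ take n (drop i.+1 w)); last by exists p.
  have iw : i < size w by rewrite sw; lia.
  have dw : drop i w = nth O w i :: drop i.+1 w by rewrite -drop_nth.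
  split.
  - by rewrite size_cat sp size_takel // size_drop sw; lia.
  - rewrite cat_path ep lp /=.
    have : sorted e (drop i w) by apply: drop_sorted.
    by rewrite dw /= -{1}(cat_take_drop n (drop i.+1 w)) cat_path => /andP[].
  - have udw : uniq (nth O w i :: drop i.+1 w) by rewrite -dw drop_uniq.
    rewrite -cat_cons cat_uniq up /=; apply/andP; split; last first.
      by rewrite take_uniq //; case/andP: udw.
    apply/hasPn => y yt; have yd := mem_take yt.
    rewrite -[_ \in _]/(y \in O :: p) lastI mem_rcons in_cons negb_or lp.
    apply/andP; split.
      by case/andP: udw => h1 _; apply: contraNneq h1 => <-.
    by apply/negP => /bp /negP; apply; apply: mem_drop yd.
move=> y [sy ey uy]; rewrite -[u i * _]/(_ * _).
(* As [h] is fixed, [y] determines the hitting vertex [v] and the [n] steps [m] that follow it. *)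
pose v := last O (take h y); pose m := drop h y.
have Vv : V v.
  by apply: path_last eV VO _; move: ey; rewrite -{1}(cat_take_drop h y) cat_path => /andP[].
have em : path e v m by move: ey; rewrite -{1}(cat_take_drop h y) cat_path => /andP[].
have Vl := path_last eV Vv em.
apply: (@le_card_sub _ _ (fun w => [/\ size w = n.*2.+1, sorted e w, uniq w,
    nth O w i = v & take n (drop i.+1 w) = m])).
  move=> w [[sw ew uw _] [p [sp ep lp yE]]]; split=> //.
    by rewrite /v yE take_size_cat.
  by rewrite /m yE drop_size_cat.
have wE w : size w = n.*2.+1 -> nth O w i = v -> take n (drop i.+1 w) = m ->
    w = take i w ++ v :: m ++ drop (i.+1 + n) w.
  move=> sw wv wm; rewrite -{1}(cat_take_drop i w) (drop_nth O) ?wv; last by rewrite sw; lia.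
  by rewrite -{1}(cat_take_drop n (drop i.+1 w)) wm drop_drop addnC.
(* The first [i] steps are read backwards, so that they form a walk from [v]. *)
apply: (@le_card_rel _ _ (fun w z => rev (take i w) = z) _ (saw e v i)); last 2 first.
- exact: hu.
- move=> z _.
  apply: (le_card_inj (f := drop (i.+1 + n)) _ _ (hu Vl)).
    move=> w w' [[sw _ _ wv wm] wz] [[sw' _ _ wv' wm'] wz'] dE.
    rewrite (wE w) // (wE w') // dE; congr (_ ++ _).
    by rewrite -[LHS]revK wz -wz' revK.
  move=> w [[sw ew uw wv wm] _].
  have wE' := wE _ sw wv wm; split.
  + by rewrite size_drop sw; lia.
  + move: ew; rewrite {1}wE'; case: (take i w) => [|t s] /=.
      by rewrite cat_path => /andP[].
    by rewrite cat_path /= cat_path => /and3P[_ _ /andP[]].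
  + move: uw; rewrite {1}wE' cat_uniq => /and3P[_ _].
    by rewrite -cat_cons lastI cat_rcons cat_uniq => /and3P[].
move=> w [sw ew uw wv wm]; exists (rev (take i w)) => //.
have wE' := wE _ sw wv wm; split.
- by rewrite size_rev size_takel // sw; lia.
- have : sorted e (rev (rcons (take i w) v)).
    rewrite rev_sorted; have : sorted e (rcons (take i w) v).
      have -> : rcons (take i w) v = take i.+1 w.
        by rewrite -wv -take_nth // sw; lia.
      exact: take_sorted.
    by apply: sub_sorted => x z; rewrite e_sym.
  by rewrite rev_rcons.
- rewrite -rev_rcons rev_uniq -wv -take_nth ?take_uniq // sw; lia.
Qed.

(** A shortest path from [O] to the walk hits it at some time [i]. If [i > n], reversing the walk
    makes the part after the hit the longer one; hence the factor 2. *)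
Lemma le_card_near g n :
  le_card (fun w => size w = n.*2.+1 /\ near_walk g w)
    ((\sum_(i < n.+1) \sum_(h < g.+1) c (h + n) * (u i * u (n - i))) * 2).
Proof.
pose P w := exists i h, [/\ i < n.+1, h < g.+1 & [/\ size w = n.*2.+1, sorted e w, uniq w &
      exists p, [/\ size p = h, path e O p, uniq (O :: p), last O p = nth O w i &
                    forall y, y \in belast O p -> y \notin w]]].
have PB : le_card P (\sum_(i < n.+1) \sum_(h < g.+1) c (h + n) * (u i * u (n - i))).
  pose P1 i w := exists h, [/\ h < g.+1 & [/\ size w = n.*2.+1, sorted e w, uniq w &
      exists p, [/\ size p = h, path e O p, uniq (O :: p), last O p = nth O w i &
                    forall y, y \in belast O p -> y \notin w]]].
  apply: (@le_card_bigcup _ P1 _ _ (fun i => \sum_(h < g.+1) c (h + n) * (u i * u (n - i)))).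
    by move=> w [i [h [? ? ?]]]; exists i => //; exists h.
  move=> i ilen; pose P2 h w := [/\ size w = n.*2.+1, sorted e w, uniq w &
      exists p, [/\ size p = h, path e O p, uniq (O :: p), last O p = nth O w i &
                    forall y, y \in belast O p -> y \notin w]].
  apply: (@le_card_bigcup _ P2 _ _ (fun h => c (h + n) * (u i * u (n - i)))).
    by move=> w [h [? ?]]; exists h.
  by move=> h _; apply: le_card_hit.
rewrite muln2 -[X in le_card _ X]addnn; apply: (@le_card_sub _ _ (fun w => P w \/ P (rev w))); last first.
  apply: (@le_card_or _ P (fun w => P (rev w))) => //; apply: (le_card_inj (f := rev) _ _ PB) => //.
  by move=> w w' _ _; apply: (can_inj revK).
move=> w [sw [ew uw rw]].
have [p [ep lp sp]] : reach O (nth O w 0) g by apply: rw; rewrite mem_nth // sw.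
have [|p' [ep' up' lp' bp' sp']] := @first_hit (mem w) O p ep.
  by rewrite lp mem_nth // sw.
have hg : size p' < g.+1 by rewrite ltnS (leq_trans sp').
set i := index (last O p') w.
have iw : i < size w by rewrite index_mem.
have [iln|nli] := leqP i n.
  left; exists i, (size p'); split=> //; split=> //.
  by exists p'; split=> //; rewrite nth_index.
right; exists (size w - i.+1), (size p'); split=> //; first by rewrite sw; lia.
split; rewrite ?size_rev ?rev_uniq //.
  by rewrite rev_sorted; apply: sub_sorted ew => x y; rewrite e_sym.
exists p'; split=> //; last by move=> y /bp'; rewrite mem_rev.
by rewrite nth_rev ?subnSK ?subKn ?nth_index // ?(ltnW iw) ?leq_subr.
Qed.
End CellCounting.

Section Interior.
Local Open Scope nat_scope.
Variable T : eqType.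

(** Only interior vertices are constrained: both ends of the path may satisfy [P]. *)
Definition avoids (P : T -> Prop) (a : T) (p : seq T) : Prop :=
  forall x, x \in behead (belast a p) -> ~ P x.

Lemma leq_subr_of a b m : a + b <= m -> b <= m - a. Proof. lia. Qed.

Lemma last_take (a : T) p i : i <= size p -> last a (take i p) = nth a (a :: p) i.
Proof.
move=> ip; rewrite (last_nth a) size_takel //.
by rewrite -[a :: take i p]/(take i.+1 (a :: p)) nth_take.
Qed.

Lemma interiorP (a x : T) p : reflect
  (exists i, [/\ 0 < i, i < size p & nth a (a :: p) i = x]) (x \in behead (belast a p)).
Proof.
have E i : i < size p -> nth a (a :: p) i = nth a (belast a p) i.
  by move=> ip; rewrite lastI nth_rcons size_belast ip.
apply: (iffP (nthP a)) => [[i]|[i [i0 ip <-]]].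
  rewrite size_behead size_belast nth_behead => ip <-; exists i.+1; split=> //; last rewrite E //.
    by move: ip; case: (size p).
  by move: ip; case: (size p).
exists i.-1; rewrite ?size_behead ?size_belast ?nth_behead ?prednK ?E //.
by rewrite -ltnS !prednK // (leq_trans _ ip).
Qed.

End Interior.

(** * Walks cut at the corners of cells of two levels *)

Section CellCounting.
Local Open Scope nat_scope.
Variables (T : choiceType) (e : rel T) (V : T -> Prop) (O : T).
Hypothesis e_sym : symmetric e.
Hypothesis eV : forall x y, e x y -> V y.
Hypothesis VO : V O.
Variables u c : nat -> nat.
Hypothesis hu : forall a n, V a -> le_card (saw e a n) (u n).
Hypothesis hc : forall n, le_card (saw e O n) (c n).
Variables (N : nat) (B : nat -> T -> Prop) (g : nat -> nat).

(* For the graph of a fractal, B k consists of the corners of the level-k cells. A walk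
   avoiding them stays in one cell, which the maps F move to the cell of the root. *)
Definition cell_charts : Prop := forall k z, V z -> exists F : nat -> T -> T,
  forall p, 0 < size p -> path e z p -> avoids (B k) z p ->
  exists i, [/\ i < N, injective (F i), path e (F i z) (map (F i) p),
     forall x, x \in z :: p -> reach e O (F i x) (g k)
   & B k z -> F i z = O].

Definition separated k n : Prop := forall x y p, B k x -> B k y -> x <> y ->
  path e x p -> last x p = y -> n <= size p.

Hypothesis charts : cell_charts.

Definition near_bound k n : nat :=
  (\sum_(i < n.+1) \sum_(h < (g k).+1) c (h + n) * (u i * u (n - i))) * 2.

(** Each of the [N] charts carries the walks that it serves injectively to walks near [O], which
    [le_card_near] counts. *)
Lemma le_card_free k a n : V a -> 0 < n ->
  le_card (fun p => saw e a n.*2 p /\ avoids (B k) a p) (N * near_bound k n).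
Proof.
move=> Va n0; have [F FP] := charts k Va.
have -> : N * near_bound k n = \sum_(i < N) near_bound k n by rewrite sum_nat_const card_ord.
apply: (@le_card_bigcup _ (fun i p => [/\ saw e a n.*2 p, injective (F i),
    path e (F i a) (map (F i) p)
  & forall x, x \in a :: p -> reach e O (F i x) (g k)]) _ _ (fun=> near_bound k n)).
  move=> p [[sp ep up] ap]; have [|i [iN iF eF rF _]] := FP p _ ep ap.
    by rewrite sp; lia.
  by exists i.
move=> i _; pose f (p : seq T) := F i a :: map (F i) p.
apply: (le_card_inj (f := f) _ _ (@le_card_near _ _ _ _ e_sym eV VO _ _ hu hc (g k) n)).
  by move=> p p' [_ iF _ _] [_ _ _ _] [] /(inj_map iF).
move=> p [[sp ep up] iF eF rF]; split; first by rewrite /f /= size_map sp.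
split=> //.
  by rewrite -[f p]/(map (F i) (a :: p)) map_inj_uniq.
by move=> x; rewrite -[f p]/(map (F i) (a :: p)) => /mapP[y ya ->]; apply: rF.
Qed.

(** By separation, fewer than [n] steps cannot lead from [b] to another corner. So the walk stays in
    one cell, and a chart carries it to a walk from [O]. *)
Lemma le_card_corner k b n : V b -> B k b -> 0 < n -> separated k n ->
  le_card (saw e b n) (N * c n).
Proof.
move=> Vb Bb n0 sepn; have [F FP] := charts k Vb.
have -> : N * c n = \sum_(i < N) c n by rewrite sum_nat_const card_ord.
apply: (@le_card_bigcup _ (fun i p => [/\ saw e b n p, injective (F i),
    path e (F i b) (map (F i) p) & F i b = O]) _ _ (fun=> c n)).
  move=> p [sp ep up]; have [||i [iN iF eF _ FO]] := FP p _ ep; rewrite ?sp //.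
    move=> x /interiorP[i [i0 ip xE]] Bx.
    have : n <= size (take i p).
      apply: (sepn b x) => //; last by rewrite last_take // ltnW.
        move=> bx; move: up; rewrite -[b :: p](cat_take_drop i) cat_uniq => /and3P[_ /hasPn h _].
        have : b \notin take i (b :: p).
          by apply: h; rewrite (drop_nth b) ?xE -?bx ?mem_head //= ltnW.
        by case: (i) i0 => //= j _; rewrite mem_head.
      by move: ep; rewrite -{1}(cat_take_drop i p) cat_path => /andP[].
    by rewrite size_takel ?(ltnW ip) // -sp leqNgt ip.
  by exists i => //; split=> //; apply: FO.
move=> i _; apply: (le_card_inj (f := map (F i)) _ _ (@hc n)).
  by move=> p p' [_ iF _ _] _ /(inj_map iF).
move=> p [[sp ep up] iF eF FO]; split; rewrite ?size_map -?FO //.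
by rewrite -map_cons map_inj_uniq.
Qed.

Section LongWalks.
Variables (k K n Q : nat).
Hypothesis n0 : 0 < n.
Hypothesis sepK : separated K n.
Hypothesis visits : forall a p, V a -> path e a p -> uniq (a :: p) -> avoids (B K) a p ->
  le_card (fun x => x \in behead (belast a p) /\ B k x) Q.

(** Pigeonhole: if each of the [Q.+1] blocks of [n.*2] steps had a point of [B k] in its interior,
    there would be more than [Q] such points. *)
Lemma free_block a p : V a -> path e a p -> uniq (a :: p) -> avoids (B K) a p ->
  size p = n.*2 * Q.+1 -> exists2 j, j < Q.+1 &
    avoids (B k) (last a (take (n.*2 * j) p)) (take n.*2 (drop (n.*2 * j) p)).
Proof.
move=> Va ep up ap sp; apply: contrapT => nfree.
have /choice[t tP] : forall j, exists i, j < Q.+1 ->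
    [/\ n.*2 * j < i, i < n.*2 * j.+1 & B k (nth a (a :: p) i)].
  move=> j; have [jQ|_] := boolP (j < Q.+1); last by exists 0.
  apply: contrapT => nt; apply: nfree; exists j => // x.
  move=> /interiorP[i [i0]]; have jp : n.*2 * j + n.*2 <= size p by rewrite sp; nia.
  rewrite size_takel; last by rewrite size_drop; apply: leq_subr_of.
  move=> ip <- Bx; apply: nt; exists (n.*2 * j + i) => _; split; try nia.
  move: Bx; case: i i0 ip => // i _ ip; rewrite addnS /= nth_take ?nth_drop; last exact: ltnW.
  by congr (B k _); apply: set_nth_default; lia.
have tp j : j < Q.+1 -> t j < size p by move=> jQ; have [_ ? _] := tP _ jQ; rewrite sp; nia.
have := visits Va ep up ap (s := [seq nth a (a :: p) (t j) | j <- iota 0 Q.+1]).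
rewrite size_map size_iota ltnn => H; suff : false by []; apply: H.
  rewrite map_inj_in_uniq ?iota_uniq // => i j; rewrite !mem_iota !add0n /= => iQ jQ /eqP.
  have tS l : l < Q.+1 -> t l < size (a :: p) by move=> lQ; rewrite ltnS ltnW // tp.
  rewrite nth_uniq ?tS //.
  move=> /eqP tij; have [? ? _] := tP _ iQ; have [? ? _] := tP _ jQ.
  by nia.
move=> x /mapP[j]; rewrite mem_iota add0n /= => jQ ->; have [tj _ Bj] := tP _ jQ; split=> //.
by apply/interiorP; exists (t j); split=> //; [lia|exact: tp].
Qed.

(* Either the walk meets B K early enough to be followed by n steps avoiding B K, or its
   first blocks avoid B K, and then one of them also avoids B k. *)
Lemma le_card_long a : V a -> le_card (saw e a (n.*2 * Q.+2))
  ((\sum_(i < (n.*2 * Q.+2 - n).+1) u i * (N * c n) * u (n.*2 * Q.+2 - n - i)) +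
   (\sum_(j < Q.+1) u (n.*2 * j) * (N * near_bound k n) * u (n.*2 * (Q - j).+1))).
Proof.
move=> Va; set H := n.*2 * Q.+2.
pose P1 i p := saw e a (i + n + (H - n - i)) p /\ B K (last a (take i p)).
pose P2 j p := saw e a (n.*2 * j + n.*2 + (n.*2 * (Q - j).+1)) p /\
  avoids (B k) (last a (take (n.*2 * j) p)) (take n.*2 (drop (n.*2 * j) p)).
apply: (@le_card_sub _ _ (fun p => (exists2 i, i < (H - n).+1 & P1 i p) \/
                                 (exists2 j, j < Q.+1 & P2 j p))).
  move=> p sp; have [hp|np] := pselect (exists2 i, i < (H - n).+1 & P1 i p); [by left|right].
  have [ssp ep up] := sp.
  (* One more block follows the [Q.+1] blocks inspected, so at least [n] steps remain after any
     corner met in these. *)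
  have hH : n.*2 * Q.+1 <= H - n by rewrite /H; nia.
  have [|||||j jQ aj] := @free_block a (take (n.*2 * Q.+1) p) => //.
  - by move: ep; rewrite -{1}(cat_take_drop (n.*2 * Q.+1) p) cat_path => /andP[].
  - move: up; rewrite -{1}(cat_take_drop (n.*2 * Q.+1) p).
    by rewrite -cat_cons cat_uniq => /andP[].
  - move=> x /interiorP[i [i0]]; rewrite size_takel ?ssp; last by lia.
    move=> ip xE Bx; apply: np; exists i; first by lia.
    split; first by have -> : i + n + (H - n - i) = H by lia.
    rewrite last_take ?ssp; last by lia.
    by move: xE; case: (i) i0 ip => // l _ lp; rewrite /= nth_take ?(ltnW lp) // => ->.
  - by rewrite size_takel // ssp; lia.
  exists j => //; split.
    by have -> : n.*2 * j + n.*2 + n.*2 * (Q - j).+1 = H by rewrite /H; nia.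
  have h1 : n.*2 * j <= n.*2 * Q.+1 by nia.
  have h2 : n.*2 + n.*2 * j <= n.*2 * Q.+1 by nia.
  by move: aj; rewrite !take_drop !take_takel.
apply: le_card_or.
  apply: (@le_card_bigcup _ P1 _ _ (fun i => u i * (N * c n) * u (H - n - i))) => // i iH.
  apply: (le_card_saw_block (V := V) (Q := fun b _ => B K b)) => // [|b Vb|b Vb].
  - exact: hu.
  - case: (pselect (B K b)) => Bb; last by move=> [|x s] // _ /(_ x (mem_head _ _))[].
    by apply: le_card_sub (le_card_corner Vb Bb n0 sepK) => p [].
  - exact: hu.
apply: (@le_card_bigcup _ P2 _ _
  (fun j => u (n.*2 * j) * (N * near_bound k n) * u (n.*2 * (Q - j).+1))) => // j jQ.
apply: (le_card_saw_block (V := V) (Q := fun b p => avoids (B k) b p)) => // [|b Vb|b Vb].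
- exact: hu.
- exact: le_card_free.
- exact: hu.
Qed.
End LongWalks.
End CellCounting.

(** * Growth rates *)

Section Real.
Variable R : realType.

Lemma bernoulli (y : R) n : -1 <= y -> 1 + n%:R * y <= (1 + y) ^+ n.
Proof.
move=> y1; elim: n => [|n IH]; first by rewrite mul0r addr0 expr0.
have h : (1 + n%:R * y) * (1 + y) <= (1 + y) ^+ n * (1 + y).
  by rewrite ler_wpM2r //; lra.
rewrite exprSr; apply: le_trans h; rewrite -natr1.
have : 0 <= n%:R * y ^+ 2 by rewrite mulr_ge0 ?sqr_ge0 // ler0n.
by rewrite expr2; lra.
Qed.

Lemma small_root (y : R) m : 1 < y -> exists2 t : R, 1 < t & t ^+ m <= y.
Proof.
move=> y1; have y0 : 0 < y by lra.
(* With [t = 1 / (1 - z)], Bernoulli gives [t^-m = (1 - z)^m >= 1 - m z >= 1 / y]. *)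
pose z : R := (1 - y^-1) / m.+1%:R.
have m0 : 0 < m.+1%:R :> R by rewrite ltr0n.
have yi : y^-1 < 1 by rewrite invf_lt1.
have yi0 : 0 < y^-1 by rewrite invr_gt0.
have z0 : 0 < z by rewrite divr_gt0 //; lra.
have mz : m.+1%:R * z = 1 - y^-1 by rewrite /z mulrCA divff ?mulr1 // gt_eqF.
have m1 : 1 <= m.+1%:R :> R by rewrite ler1n.
have z1 : z < 1 by nra.
exists (1 - z)^-1; first by rewrite invf_gt1 ?subr_gt0 //; lra.
rewrite exprVn invf_ple ?posrE ?exprn_gt0 ?subr_gt0 //.
have z1' : -1 <= - z by lra.
have := bernoulli m z1'; rewrite -natr1 in mz; lra.
Qed.

Lemma expr_unbounded (t A : R) : 1 < t -> exists n0, forall n, (n0 <= n)%N -> A <= t ^+ n.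
Proof.
move=> t1; have y0 : 0 < t - 1 by lra.
have [A0|A0] := leP A 0.
  by exists 0%N => n _; rewrite (le_trans A0) // exprn_ge0 //; lra.
exists (Num.Def.archi_bound (A / (t - 1))) => n hn.
have : A / (t - 1) < n%:R.
  apply: lt_le_trans (archi_boundP _) _; first by rewrite divr_ge0 //; lra.
  by rewrite ler_nat.
rewrite ltr_pdivrMr // => An.
have t1' : -1 <= t - 1 by lra.
have := bernoulli n t1'; have -> : 1 + (t - 1) = t by ring.
lra.
Qed.

(** One factor [t ^+ n] absorbs the constant and two absorb the square, by Bernoulli; the rest of
    the exponent is slack. *)
Lemma expr_ge_square (t A : R) : 1 < t ->
  exists n0, forall n, (n0 <= n)%N -> A * n.+1%:R ^+ 2 <= t ^+ (6 * n).
Proof.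
move=> t1; have y0 : 0 < t - 1 by lra.
pose y := Num.min 1 (t - 1).
have yp : 0 < y by rewrite lt_min ltr01 y0.
have [n0 n0P] := expr_unbounded (`|A| / y ^+ 2) t1.
exists n0 => n /n0P hA.
have t0 : 0 <= t by lra.
have h1 : n.+1%:R * y <= t ^+ n.
  have t1' : -1 <= t - 1 by lra.
  have e1 : 1 + (t - 1) = t by ring.
  have := bernoulli n t1'; rewrite e1; apply: le_trans.
  rewrite -natr1 mulrDl mul1r addrC lerD //; first by rewrite ge_min lexx.
  by rewrite ler_wpM2l ?ler0n // ge_min lexx orbT.
have h2 : n.+1%:R ^+ 2 * y ^+ 2 <= t ^+ n ^+ 2.
  by rewrite -exprMn ler_pXn2r // nnegrE ?exprn_ge0 // mulr_ge0 ?ler0n // ltW.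
have h3 : `|A| <= t ^+ n * y ^+ 2 by rewrite -ler_pdivrMr // exprn_gt0.
have tn1 : 1 <= t ^+ n by rewrite exprn_ege1 // ltW.
have h4 : `|A| * n.+1%:R ^+ 2 <= t ^+ n * t ^+ n ^+ 2.
  apply: (@le_trans _ _ (t ^+ n * y ^+ 2 * n.+1%:R ^+ 2)).
    by rewrite ler_wpM2r ?exprn_ge0 ?ler0n.
  by rewrite -mulrA ler_wpM2l ?exprn_ge0 // mulrC.
apply: (@le_trans _ _ (`|A| * n.+1%:R ^+ 2)).
  by rewrite ler_wpM2r ?exprn_ge0 ?ler0n // ler_norm.
apply: le_trans h4 _; rewrite -exprS mulnC exprM.
by apply: ler_weXn2l.
Qed.

Section LowerBound.
Variables (u c : nat -> nat) (mu q : R) (N D : nat).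
Hypothesis D1 : (1 <= D)%N.
Hypothesis mu1 : 1 <= mu.
Hypothesis q01 : 0 < q < 1.
Hypothesis u_exp : forall n, (u n <= D ^ n)%N.
Hypothesis cD : forall h n, (c (h + n) <= c n * u h)%N.
Hypothesis mu_le : forall n, mu ^+ n <= (u n)%:R.
Hypothesis u_le : forall dl : R, 0 < dl ->
  exists2 C : R, 1 <= C & forall n, (u n)%:R <= C * (mu * (1 + dl)) ^+ n.

(** The error terms will cost a factor [t ^+ (8 * n)], which [q] has to compensate. The exponent [E]
    ensures [D ^ g <= t ^+ n] whenever [E * g <= n]. *)
Lemma choose_scale : exists2 t : R, 1 < t /\ t ^+ 8 <= q^-1 &
  exists2 E : nat, (0 < E)%N & D%:R <= t ^+ E.
Proof.
have [q0 q1] := andP q01.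
have [|t t1 tq] := @small_root q^-1 8; first by rewrite invf_gt1.
exists t => //; have [E EP] := expr_unbounded D%:R t1.
by exists E.+1 => //; apply: EP.
Qed.

(** Let [H = 2 n (Q + 2)] and [x = mu t'] with [t'^H <= t^n]. Inserting [u_i u_j <= C^2 x^(i+j)] and
    [c_(h+n) <= c_n D^g] into the bound gives [mu^H <= u_H <= A (n+1)^2 t^n c_n x^(H-n)]. Cancelling
    [mu^(H-n)] leaves [mu^n <= t^(8n) c_n]. *)
Lemma count_lower_bound (t : R) (E Q : nat) : 1 < t -> t ^+ 8 <= q^-1 -> (0 < E)%N -> D%:R <= t ^+ E ->
  exists n0, forall n g, (n0 <= n)%N -> (E * g <= n)%N ->
  (u (n.*2 * Q.+2) <= 
    (\sum_(i < (n.*2 * Q.+2 - n).+1) u i * (N * c n) * u (n.*2 * Q.+2 - n - i)) +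
   (\sum_(j < Q.+1) u (n.*2 * j) * (N * ((\sum_(i < n.+1) \sum_(h < g.+1) c (h + n) * (u i * u (n - i))) * 2))
      * u (n.*2 * (Q - j).+1)))%N ->
  (q * mu) ^+ n <= (c n)%:R.
Proof.
move=> t1 t8 E0 DE; have [q0 q1] := andP q01.
have [t' t'1 t'Q] := small_root (2 * Q.+2) t1.
pose dl := t' - 1; have dl0 : 0 < dl by rewrite /dl; lra.
have [C C1 uC] := u_le dl0.
pose x := mu * (1 + dl); rewrite -/x in uC.
have t'E : 1 + dl = t' by rewrite /dl; ring.
have x1 : 1 <= x by rewrite /x t'E mulr_ege1 // ltW.
pose A := N%:R * C ^+ 4 * (4 * Q.+2%:R).
have [n0 n0P] := expr_ge_square A t1.
exists n0 => n g n0n Egn; move HE : (n.*2 * Q.+2)%N => H.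
have HE1 : H = (n + n + n.*2 * Q.+1)%N by rewrite -HE mulnS addnn.
have gn : (g <= n)%N by rewrite (leq_trans _ Egn) // leq_pmull.
have nH : (n <= H)%N by rewrite HE1 -addnA leq_addr.
have C0 : 0 <= C by lra.
have x0 : 0 <= x by lra.
have uu i j : (u i * u j)%:R <= C ^+ 2 * x ^+ (i + j).
  rewrite natrM exprD expr2 mulrACA ler_pM ?ler0n //; exact: uC.
rewrite -(ler_nat R) natrD => hH.
pose Y := (c n)%:R * x ^+ (H - n).
have Y0 : 0 <= Y by rewrite mulr_ge0 ?ler0n // exprn_ge0.
have S1 : (\sum_(i < (H - n).+1) u i * (N * c n) * u (H - n - i))%:R <=
    (H - n).+1%:R * (N%:R * C ^+ 2 * Y).
  rewrite natr_sum -[X in X%:R * _](card_ord (H - n).+1) mulr_natl -sumr_const.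
  apply: ler_sum => i _.
  have -> : (u i * (N * c n) * u (H - n - i) = N * c n * (u i * u (H - n - i)))%N.
    by rewrite -mulnA mulnCA.
  rewrite natrM natrM /Y; have iH : (i + (H - n - i) = H - n)%N by rewrite subnKC // -ltnS.
  have := uu i (H - n - i)%N; rewrite iH => uuH.
  have -> : N%:R * C ^+ 2 * ((c n)%:R * x ^+ (H - n)) =
            N%:R * (c n)%:R * (C ^+ 2 * x ^+ (H - n)) by ring.
  by rewrite ler_wpM2l // mulr_ge0 ?ler0n.
have cg h : (h < g.+1)%N -> (c (h + n))%:R <= (c n)%:R * D%:R ^+ g :> R.
  move=> hg; rewrite -natrX -natrM ler_nat (leq_trans (cD h n)) // leq_mul2l.
  by rewrite (leq_trans (u_exp h)) ?orbT // leq_pexp2l // -ltnS.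
have S2 : (\sum_(i < n.+1) \sum_(h < g.+1) c (h + n) * (u i * u (n - i)))%:R <=
    n.+1%:R * (g.+1%:R * ((c n)%:R * D%:R ^+ g * (C ^+ 2 * x ^+ n))).
  rewrite natr_sum -[X in X%:R * (_ * _)](card_ord n.+1) mulr_natl -sumr_const.
  apply: ler_sum => i _.
  rewrite natr_sum -[X in X%:R * _](card_ord g.+1) mulr_natl -sumr_const.
  apply: ler_sum => h _; rewrite natrM.
  have := uu i (n - i)%N; rewrite subnKC ?(ltnSE (ltn_ord i)) // => uun.
  by rewrite ler_pM ?ler0n // cg.
have S3 : (\sum_(j < Q.+1) u (n.*2 * j) * (N * ((\sum_(i < n.+1) \sum_(h < g.+1) c (h + n) * (u i * u (n - i))) * 2))
      * u (n.*2 * (Q - j).+1))%:R <=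
    Q.+1%:R * (N%:R * 2 * n.+1%:R * g.+1%:R * D%:R ^+ g * C ^+ 4 * Y).
  rewrite natr_sum -[X in X%:R * _](card_ord Q.+1) mulr_natl -sumr_const.
  apply: ler_sum => j _; set Z := (\sum_(i < n.+1) _)%N.
  have -> : (u (n.*2 * j) * (N * (Z * 2)) * u (n.*2 * (Q - j).+1) =
             N * 2 * Z * (u (n.*2 * j) * u (n.*2 * (Q - j).+1)))%N.
    by rewrite -mulnA mulnCA; congr (_ * _)%N; rewrite mulnA mulnAC.
  rewrite natrM.
  have := uu (n.*2 * j)%N (n.*2 * (Q - j).+1)%N.
  have -> : (n.*2 * j + n.*2 * (Q - j).+1 = H - n - n)%N.
    by rewrite -mulnDr addnS subnKC ?(ltnSE (ltn_ord j)) // HE1 -addnA !addKn.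
  move=> uuj.
  have -> : N%:R * 2 * n.+1%:R * g.+1%:R * D%:R ^+ g * C ^+ 4 * Y =
     (N%:R * 2 * (n.+1%:R * (g.+1%:R * ((c n)%:R * D%:R ^+ g * (C ^+ 2 * x ^+ n))))) *
     (C ^+ 2 * x ^+ (H - n - n)).
    have -> : Y = (c n)%:R * (x ^+ n * x ^+ (H - n - n)).
      by rewrite /Y -exprD; congr (_ * _ ^+ _); rewrite HE1 -addnA !addKn.
    ring.
  by rewrite ler_pM ?ler0n // natrM natrM ler_wpM2l ?mulr_ge0 ?ler0n.
have Dg1 : 1 <= D%:R ^+ g :> R by rewrite exprn_ege1 // ler1n.
have t0 : 0 <= t by lra.
have DgT : D%:R ^+ g <= t ^+ n.
  apply: (@le_trans _ _ (t ^+ E ^+ g)); first by rewrite lerXn2r ?nnegrE ?ler0n ?exprn_ge0.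
  by rewrite -exprM ler_weXn2l // ltW.
have xT : x ^+ (H - n) <= mu ^+ (H - n) * t ^+ n.
  have mu0' : 0 <= mu by apply: le_trans mu1.
  rewrite /x exprMn ler_wpM2l ?exprn_ge0 // t'E.
  apply: (@le_trans _ _ (t' ^+ H)).
    by rewrite ler_weXn2l ?leq_subr // ltW.
  have -> : H = (2 * Q.+2 * n)%N by clear -HE; rewrite -HE -muln2; ring.
  have t'0 : 0 <= t' by lra.
  by rewrite exprM lerXn2r ?nnegrE ?exprn_ge0.
have tot : mu ^+ H <= A * n.+1%:R ^+ 2 * t ^+ n * Y.
  apply: le_trans (mu_le H) _; apply: le_trans hH _; apply: le_trans (lerD S1 S3) _.
  have gn' : g.+1%:R <= n.+1%:R :> R by rewrite ler_nat ltnS.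
  have Hn : (H - n).+1%:R <= 2 * Q.+2%:R * n.+1%:R :> R.
    rewrite -natrM -natrM ler_nat.
    have -> : (2 * Q.+2 * n.+1 = H + 2 * Q.+2)%N by clear -HE; rewrite -HE -muln2; ring.
    by rewrite (leq_ltn_trans (leq_subr n H)) // -{1}(addn0 H) ltn_add2l.
  have n1 : 1 <= n.+1%:R :> R by rewrite ler1n.
  have C24 : C ^+ 2 <= C ^+ 4 by apply: ler_weXn2l.
  have N0 : 0 <= N%:R :> R by rewrite ler0n.
  have t1n : 1 <= t ^+ n by rewrite exprn_ege1 // ltW.
  have -> : A * n.+1%:R ^+ 2 * t ^+ n * Y =
    2 * Q.+2%:R * n.+1%:R * (N%:R * C ^+ 4 * Y) * (n.+1%:R * t ^+ n) +
    Q.+2%:R * (N%:R * 2 * n.+1%:R * n.+1%:R * t ^+ n * C ^+ 4 * Y).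
    by rewrite /A; ring.
  have Q0 : 0 <= Q.+2%:R :> R by rewrite ler0n.
  have nn0 : 0 <= n.+1%:R :> R by rewrite ler0n.
  apply: lerD.
    have h1 : (H - n).+1%:R * (N%:R * C ^+ 2 * Y) <= 2 * Q.+2%:R * n.+1%:R * (N%:R * C ^+ 4 * Y).
      by rewrite ler_pM ?mulr_ge0 ?exprn_ge0 // ler_wpM2r // ler_wpM2l.
    apply: le_trans h1 _; rewrite ler_peMr ?mulr_ege1 //.
    by rewrite !mulr_ge0 ?exprn_ge0.
  apply: ler_pM; rewrite ?ler0n ?mulr_ge0 ?exprn_ge0 ?ler0n //.
    by rewrite ler_nat.
  rewrite ler_wpM2r // ler_wpM2r ?exprn_ge0 //.
  apply: ler_pM; rewrite ?ler0n ?mulr_ge0 ?exprn_ge0 ?ler0n //.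
  by rewrite ler_wpM2l ?mulr_ge0.
have mu0 : 0 < mu by apply: lt_le_trans mu1.
have tot2 : mu ^+ n <= A * n.+1%:R ^+ 2 * t ^+ n * t ^+ n * (c n)%:R.
  rewrite -(ler_pM2r (exprn_gt0 (H - n) mu0)) -exprD subnKC //.
  apply: le_trans tot _; rewrite /Y.
  have A0 : 0 <= A by rewrite /A !mulr_ge0 ?exprn_ge0 ?ler0n.
  have -> : A * n.+1%:R ^+ 2 * t ^+ n * t ^+ n * (c n)%:R * mu ^+ (H - n) =
    A * n.+1%:R ^+ 2 * t ^+ n * ((c n)%:R * (mu ^+ (H - n) * t ^+ n)) by ring.
  by rewrite ler_wpM2l ?ler_wpM2l // ?mulr_ge0 ?exprn_ge0 ?ler0n.
have cn0 : 0 <= (c n)%:R :> R by rewrite ler0n.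
have tot3 : mu ^+ n <= t ^+ (8 * n) * (c n)%:R.
  apply: le_trans tot2 _; rewrite ler_wpM2r //.
  have -> : (8 * n = 6 * n + n + n)%N by clear; lia.
  rewrite (exprD _ (6 * n + n)) (exprD _ (6 * n)) ler_wpM2r ?exprn_ge0 // ler_wpM2r ?exprn_ge0 //.
  exact: n0P.
rewrite exprMn.
apply: (@le_trans _ _ (q ^+ n * (q^-1 ^+ n * (c n)%:R))).
  rewrite ler_wpM2l ?exprn_ge0 ?(ltW q0) //; apply: le_trans tot3 _.
  by rewrite ler_wpM2r // exprM lerXn2r ?nnegrE ?exprn_ge0 ?invr_ge0 // ltW.
by rewrite mulrA -exprMn divff ?expr1n ?mul1r // gt_eqF.
Qed.
End LowerBound.
End Real.

Section Roots.
Variable R : realType.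

Lemma powR_rootK (a : R) n : 0 <= a -> (0 < n)%N -> (a `^ n%:R^-1) ^+ n = a.
Proof.
by move=> a0 n0; rewrite -powR_mulrn ?powR_ge0 // -powRrM mulVf ?powRr1 // pnatr_eq0 -lt0n.
Qed.

Lemma powR_root_le (a b : R) n : 0 <= a -> 0 <= b -> (0 < n)%N ->
  (a `^ n%:R^-1 <= b) = (a <= b ^+ n).
Proof.
by move=> a0 b0 n0; rewrite -{2}(powR_rootK a0 n0) ler_pXn2r // nnegrE powR_ge0.
Qed.

Lemma powR_root_ge (a b : R) n : 0 <= a -> 0 <= b -> (0 < n)%N ->
  (b <= a `^ n%:R^-1) = (b ^+ n <= a).
Proof.
by move=> a0 b0 n0; rewrite -{2}(powR_rootK a0 n0) ler_pXn2r // nnegrE powR_ge0.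
Qed.

Lemma cvg_root (a : nat -> R) (mu : R) : 0 < mu -> (forall n, 0 <= a n) ->
  (forall q, 0 < q < 1 -> exists n0, forall n, (n0 <= n)%N -> (q * mu) ^+ n <= a n) ->
  (forall dl, 0 < dl -> exists n0, forall n, (n0 <= n)%N -> a n <= (mu * (1 + dl)) ^+ n) ->
  (fun n => a n `^ n%:R^-1) @ \oo --> mu.
Proof.
move=> mu0 a0 lo up; apply/cvgrPdist_le => eps eps0.
pose dl := eps / mu; have dl0 : 0 < dl by rewrite divr_gt0.
have dlmu : mu * dl = eps by rewrite mulrC divfK ?gt_eqF.
(* The second entry gives [q * mu >= mu - eps]; the first keeps [q] positive. *)
pose q := Num.max (1 / 2) (1 - dl).
have q01 : 0 < q < 1.
  by rewrite lt_max gt_max; apply/andP; split; [apply/orP; left; lra|apply/andP; split; lra].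
have [n1 h1] := lo _ q01; have [n2 h2] := up _ dl0.
exists (maxn 1 (maxn n1 n2)) => // n /=; rewrite !geq_max => /and3P[n0 /h1 lo_n /h2 up_n].
have q0 : 0 <= q by case/andP: q01 => /ltW.
have lo' : q * mu <= a n `^ n%:R^-1 by rewrite powR_root_ge ?mulr_ge0 // ltW.
have up' : a n `^ n%:R^-1 <= mu * (1 + dl).
  by rewrite powR_root_le ?mulr_ge0 ?addr_ge0 ?ler01 // ltW.
have q' : mu - eps <= q * mu.
  rewrite -dlmu -[X in X - _]mulr1 -mulrBr mulrC ler_wpM2r ?(ltW mu0) //.
  by rewrite /q le_max lexx orbT.
by rewrite ler_norml; apply/andP; split; lra.
Qed.
End Roots.

(** * Growth rate of a submultiplicative sequence *)

Section Fekete.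
Variables (R : realType) (u : nat -> nat).
Hypothesis umul : forall m n, (u (m + n) <= u m * u n)%N.
Hypothesis u_ge1 : forall n, (0 < u n)%N.

Let roots : set R := [set (u n)%:R `^ n%:R^-1 | n in [set n | (1 <= n)%N]].
Definition growth_rate : R := inf roots.
Local Notation mu := growth_rate.

Let u0 n : 0 <= (u n)%:R :> R. Proof. by rewrite ler0n. Qed.

Let roots_ge1 : lbound roots 1.
Proof. by move=> _ [n n1 <-]; rewrite powR_root_ge // expr1n ler1n. Qed.

Let roots_inf : has_inf roots.
Proof. by split; [exists ((u 1)%:R `^ 1%:R^-1); exists 1%N|exists 1]. Qed.

Lemma growth_rate_ge1 : 1 <= mu.
Proof. by apply: lb_le_inf; [case: roots_inf|exact: roots_ge1]. Qed.

Lemma growth_rate_le_root n : (0 < n)%N -> mu <= (u n)%:R `^ n%:R^-1.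
Proof. by move=> n0; apply: ge_inf; [case: roots_inf|exists n]. Qed.

Lemma growth_rate_adherent (eps : R) : 0 < eps ->
  exists2 n, (0 < n)%N & (u n)%:R `^ n%:R^-1 < mu + eps.
Proof. by move=> e0; have [_ [n n1 <-] h] := inf_adherent e0 roots_inf; exists n. Qed.

Lemma expr_growth_rate_le n : mu ^+ n <= (u n)%:R.
Proof.
case: n => [|n]; first by rewrite expr0 ler1n.
have := growth_rate_le_root (ltn0Sn n); rewrite powR_root_ge //.
exact: le_trans ler01 growth_rate_ge1.
Qed.

(** Since [x = mu (1 + dl)] exceeds the infimum, [u_m <= x^m] for some [m]. Blocks of length [m] are
    split off until fewer than [m] steps remain, and [C] bounds what is left. *)
Lemma le_expr_growth_rate (dl : R) : 0 < dl ->
  exists2 C, 1 <= C & forall n, (u n)%:R <= C * (mu * (1 + dl)) ^+ n.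
Proof.
move=> dl0; have mu1 := growth_rate_ge1; set x := mu * (1 + dl).
have mux : mu < x by rewrite /x mulrDr mulr1 ltrDl mulr_gt0 // (lt_le_trans ltr01).
have x1 : 1 <= x by lra.
have [_ [m m1 <-] um] := inf_lt roots_inf.1 mux.
have {}um : (u m)%:R <= x ^+ m by rewrite -powR_root_le //; lra.
pose C := 1 + \sum_(r < m) (u r)%:R : R; exists C.
  by rewrite lerDl sumr_ge0.
have C0 : 0 <= C by rewrite addr_ge0 ?sumr_ge0.
move=> n; elim/ltn_ind: n => n IH; have [nm|mn] := ltnP n m.
  apply: (@le_trans _ _ C); last by rewrite ler_peMr // exprn_ege1.
  by rewrite /C (bigD1 (Ordinal nm)) //= addrCA lerDl addr_ge0 ?sumr_ge0.
have := umul m (n - m); rewrite subnKC // -(ler_nat R) natrM => /le_trans; apply.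
have -> : C * x ^+ n = x ^+ m * (C * x ^+ (n - m)) by rewrite mulrCA -exprD subnKC.
by rewrite ler_pM // IH // ltn_subrL m1 (leq_trans m1).
Qed.

(** With [t^2 <= 1 + dl], one factor [t^n] is spent on the growth and the other absorbs the constant
    [C]. *)
Lemma growth_rate_upper (dl : R) : 0 < dl ->
  exists n0, forall n, (n0 <= n)%N -> (u n)%:R <= (mu * (1 + dl)) ^+ n.
Proof.
move=> dl0; have [|t t1 t2] := @small_root R (1 + dl) 2; first by lra.
have t0 : 0 < t - 1 by lra.
have [C C1 uC] := le_expr_growth_rate t0.
have [n0 n0P] := expr_unbounded C t1.
exists n0 => n /n0P Cn; apply: le_trans (uC n) _.
have mu1 := growth_rate_ge1.
have e1 : 1 + (t - 1) = t by ring.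
have mu0 : 0 <= mu by apply: le_trans mu1.
have tn0 : 0 <= t ^+ n by rewrite exprn_ge0 //; lra.
rewrite e1 [X in _ <= X]exprMn exprMn mulrCA ler_wpM2l ?exprn_ge0 //.
apply: (@le_trans _ _ (t ^+ n * t ^+ n)); first by rewrite ler_wpM2r.
by rewrite -exprMn -expr2 lerXn2r ?nnegrE ?exprn_ge0 //; lra.
Qed.

Lemma cvg_root_growth_rate : (fun n => (u n)%:R `^ n%:R^-1) @ \oo --> mu.
Proof.
have mu1 := growth_rate_ge1.
apply: cvg_root => // [|q /andP[q0 q1]|]; first lra; last exact: growth_rate_upper.
exists 0%N => n _; apply: le_trans (expr_growth_rate_le n).
by rewrite lerXn2r ?nnegrE ?mulr_ge0 //; nra.
Qed.
End Fekete.

(** * Limits of the walk counts, given charts, scales and bounds on visits *)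

Section Growth.
Variables (T : choiceType) (e : rel T) (V : T -> Prop) (O : T).
Hypothesis e_sym : symmetric e.
Hypothesis eV : forall x y, e x y -> V y.
Hypothesis VO : V O.
Variables (u c : nat -> nat) (D : nat).
Hypothesis hu : forall a n, V a -> le_card (saw e a n) (u n).
Hypothesis u_min : forall n m, (forall a, V a -> le_card (saw e a n) m) -> (u n <= m)%N.
Hypothesis hc : forall n, le_card (saw e O n) (c n).
Hypothesis c_min : forall n m, le_card (saw e O n) m -> (c n <= m)%N.
Hypothesis c_ge1 : forall n, (0 < c n)%N.
Hypothesis deg : forall x, V x -> le_card (fun y => e x y) D.

Lemma c_le_u n : (c n <= u n)%N. Proof. by apply: c_min; apply: hu. Qed.

Lemma u_gt0 n : (0 < u n)%N. Proof. exact: leq_trans (c_ge1 n) (c_le_u n). Qed.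

Lemma u_mul m n : (u (m + n) <= u m * u n)%N.
Proof. by apply: u_min => a Va; apply: (le_card_sawD eV Va) => // *; apply: hu. Qed.

Lemma c_mul h n : (c (h + n) <= c n * u h)%N.
Proof. by rewrite addnC; apply: c_min; apply: (le_card_sawD eV VO) => // *; apply: hu. Qed.

Lemma u1 : (u 1 <= D)%N.
Proof. by apply: u_min => a Va; apply/le_card_saw1/deg. Qed.

Lemma u_exp n : (u n <= D ^ n)%N.
Proof. by apply: u_min => a Va; apply: le_card_saw_exp Va. Qed.

(** After at least one step, the vertex visited just before is a neighbour of the current one and is
    forbidden, so at most [D - 1] continuations remain. *)
Lemma u_succ n : (u n.+2 <= u n.+1 * D.-1)%N.
Proof.
apply: u_min => a Va.
apply: (@le_card_rel _ _ (fun p p1 => take n.+1 p = p1) _ (saw e a n.+1)).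
- by move=> p sp; exists (take n.+1 p) => //; apply: saw_take sp.
- exact: hu.
move=> p1 [sp1 ep1 up1].
have Vl := path_last eV Va ep1.
have [b bl nb] : exists2 b, e (last a p1) b & b \in belast a p1.
  move: sp1 ep1 up1; case/lastP: p1 {Vl} => // p1 x _.
  rewrite rcons_path last_rcons belast_rcons e_sym => /andP[_ ex] _.
  by exists (last a p1); rewrite ?mem_last.
apply: (@le_card_sub _ _ (fun p => [/\ p = rcons p1 (last a p), e (last a p1) (last a p)
     & last a p \notin a :: p1])).
  move=> p [[sp ep up] t1]; move: (size_drop n.+1 p); rewrite sp subSnn.
  case E : (drop n.+1 p) => [|x [|? ?]] // _.
  have pE : p = rcons p1 x by rewrite -(cat_take_drop n.+1 p) E t1 cats1.
  rewrite pE last_rcons; split=> //.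
    by move: ep; rewrite pE rcons_path => /andP[].
  by move: up; rewrite pE -rcons_cons rcons_uniq => /andP[].
move=> s us sP; have D0 : (0 < D)%N.
  by apply: (deg Vl (s := [:: b])) => // x; rewrite inE => /eqP ->.
rewrite -ltnS prednK // -(size_map (last a)).
apply: (deg Vl (s := b :: map (last a) s)) => [|x] /=; last first.
  by rewrite inE => /orP[/eqP ->//|/mapP[p /sP[_ ? _] ->]].
apply/andP; split.
  apply/negP => /mapP[p /sP[_ _ +] bE]; rewrite -bE lastI mem_rcons in_cons nb orbT //.
by rewrite map_inj_in_uniq // => p p' /sP[-> _ _] /sP[-> _ _]; rewrite !last_rcons => ->.
Qed.

Lemma D_ge2 : (2 <= D)%N.
Proof.
have := leq_trans (u_gt0 2) (u_succ 0); rewrite muln_gt0 => /andP[_].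
by case: (D) => [|[]].
Qed.

Lemma u_exp_pred n : (u n.+1 <= D * D.-1 ^ n)%N.
Proof.
elim: n => [|n IH]; first by rewrite expn0 muln1 u1.
by rewrite (leq_trans (u_succ n)) // expnSr mulnA leq_mul.
Qed.

Variable R : realType.
Local Notation mu := (growth_rate R u).

(** From [mu^(n+1) <= D (D-1)^n], the powers of [mu / (D-1)] are bounded, so this ratio cannot
    exceed 1. *)
Lemma growth_rate_le_degree : mu <= D%:R - 1.
Proof.
have D2 := D_ge2; have -> : D%:R - 1 = D.-1%:R :> R.
  by rewrite -(natrB _ (ltnW D2)) subn1.
have d0 : 0 < D.-1%:R :> R by rewrite ltr0n; lia.
have mu1 : 1 <= mu := growth_rate_ge1 R u_gt0.
rewrite leNgt; apply/negP => lt.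
have t1 : 1 < mu / D.-1%:R by rewrite ltr_pdivlMr // mul1r.
have [n0 /(_ n0.+1 (leqnSn _))] := expr_unbounded (D%:R + 1) t1.
rewrite exprMn exprVn ler_pdivlMr ?exprn_gt0 //.
have := expr_growth_rate_le R u_gt0 n0.+1.
have := u_exp_pred n0; rewrite -(ler_nat R) natrM natrX => h1 h2 h3.
have : D.-1%:R ^+ n0.+1 >= D.-1%:R ^+ n0 :> R.
  by apply: ler_weXn2l; rewrite ?ler1n //; lia.
have : 0 < D.-1%:R ^+ n0 :> R by rewrite exprn_gt0.
have : 0 <= D%:R :> R by [].
by nra.
Qed.

Variables (N : nat) (B : nat -> T -> Prop) (g : nat -> nat).
Hypothesis charts : cell_charts e V O N B g.
Hypothesis scales : forall E, exists s n0, forall n, (n0 <= n)%N ->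
  exists2 k, separated e B (k + s) n & (E * g k <= n)%N.
Hypothesis visits : forall s, exists Q, forall k a p, V a -> path e a p -> uniq (a :: p) ->
  avoids (B (k + s)) a p -> le_card (fun x => x \in behead (belast a p) /\ B k x) Q.

(** The choices are made in this order: [q] gives [t] and [E], then [E] gives the level gap [s], and
    [s] gives [Q]. All of them precede [n]; only the level [k] depends on it. *)
Lemma root_count_lower (q : R) : 0 < q < 1 ->
  exists n0, forall n, (n0 <= n)%N -> (q * mu) ^+ n <= (c n)%:R.
Proof.
move=> q01; have mu1 : 1 <= mu := growth_rate_ge1 R u_gt0.
have [t [t1 t8] [E E0 DE]] := choose_scale D q01.
have [s [n1 n1P]] := scales E; have [Q QP] := visits s.
have D1 := ltnW D_ge2.
have [n2 n2P] := count_lower_bound N D1 mu1 q01 u_exp c_mul (expr_growth_rate_le R u_gt0)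
  (fun dl => @le_expr_growth_rate R u u_mul u_gt0 dl) Q t1 t8 E0 DE.
exists (maxn 1 (maxn n1 n2)) => n; rewrite !geq_max => /and3P[n0 /n1P[k sk Eg] n2n].
apply: (n2P n (g k)) => //; apply: u_min => a Va.
exact: (le_card_long e_sym eV VO hu hc charts n0 sk (QP k)).
Qed.

Lemma cvg_root_count : (fun n => (c n)%:R `^ n%:R^-1) @ \oo --> mu.
Proof.
have mu1 : 1 <= mu := growth_rate_ge1 R u_gt0.
apply: cvg_root => //; first lra; first exact: root_count_lower.
move=> dl /(growth_rate_upper u_mul u_gt0)[n0 n0P]; exists n0 => n /n0P.
by apply: le_trans; rewrite ler_nat c_le_u.
Qed.
End Growth.

(** * Geometry of nested fractals *)

Section Euclid.
Variables (R : realType) (d : nat).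
Local Notation E := 'cV[R]_d.
Implicit Types x y z v : E.

Definition normsq x : R := dotv x x.

Lemma dotvC x y : dotv x y = dotv y x.
Proof. by apply: eq_bigr => k _; rewrite mulrC. Qed.

Lemma dotvDl x y z : dotv (x + y) z = dotv x z + dotv y z.
Proof. by rewrite -big_split; apply: eq_bigr => k _; rewrite mxE mulrDl. Qed.

Lemma dotvZl a x y : dotv (a *: x) y = a * dotv x y.
Proof. by rewrite mulr_sumr; apply: eq_bigr => k _; rewrite mxE mulrA. Qed.

Lemma dotvNl x y : dotv (- x) y = - dotv x y.
Proof. by rewrite -scaleN1r dotvZl mulN1r. Qed.

Lemma dotvDr x y z : dotv z (x + y) = dotv z x + dotv z y.
Proof. by rewrite dotvC dotvDl !(dotvC z). Qed.

Lemma dotvZr a x y : dotv y (a *: x) = a * dotv y x.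
Proof. by rewrite dotvC dotvZl (dotvC y). Qed.

Lemma dotvNr x y : dotv y (- x) = - dotv y x.
Proof. by rewrite dotvC dotvNl (dotvC y). Qed.

Definition dotvE := (dotvDl, dotvDr, dotvZl, dotvZr, dotvNl, dotvNr).

Lemma dotv_mulmx (x y : E) : dotv x y = (x^T *m y) ord0 ord0.
Proof. by rewrite mxE; apply: eq_bigr => k _; rewrite mxE. Qed.

Lemma dotv_orthogonal (U : 'M[R]_d) x y : U^T *m U = 1%:M -> dotv (U *m x) (U *m y) = dotv x y.
Proof. by move=> UU; rewrite !dotv_mulmx trmx_mul -mulmxA (mulmxA _ U) UU mul1mx. Qed.

Lemma normsq_ge0 x : 0 <= normsq x.
Proof. by apply: sumr_ge0 => k _; rewrite -expr2 sqr_ge0. Qed.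

Lemma normsq_eq0 x : (normsq x == 0) = (x == 0).
Proof.
apply/idP/eqP => [|->]; last first.
  by rewrite /normsq -(scale0r 0) dotvZl mul0r.
rewrite psumr_eq0 => [/allP h|k _]; last by rewrite -expr2 sqr_ge0.
apply/matrixP => i j; rewrite ord1 mxE; apply/eqP.
by have := h i (mem_index_enum _); rewrite /= mulf_eq0 orbb.
Qed.

Lemma normsq_gt0 x : (0 < normsq x) = (x != 0).
Proof. by rewrite lt_neqAle normsq_ge0 andbT eq_sym normsq_eq0. Qed.

Lemma normsqB_gt0 x y : x <> y -> 0 < normsq (x - y).
Proof. by move=> xy; rewrite normsq_gt0 subr_eq0; apply/eqP. Qed.

Lemma normsq0 : normsq 0 = 0.
Proof. by apply/eqP; rewrite normsq_eq0. Qed.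

Lemma normsqN x : normsq (- x) = normsq x.
Proof. by rewrite /normsq !dotvE opprK. Qed.

Lemma normsqBC x y : normsq (x - y) = normsq (y - x).
Proof. by rewrite -normsqN opprB. Qed.

Lemma normsqZD (a : R) x y :
  normsq (a *: x + y) = normsq y + 2 * a * dotv y x + a ^+ 2 * normsq x.
Proof. by rewrite /normsq !dotvE (dotvC x y); ring. Qed.

Lemma enorm_sqr x : enorm x ^+ 2 = normsq x.
Proof. by rewrite sqr_sqrtr // normsq_ge0. Qed.

Lemma coord_le_enorm x k : `|x k ord0| <= enorm x.
Proof.
rewrite -sqrtr_sqr ler_wsqrtr // expr2 /dotv (bigD1 k) //= lerDl.
by apply: sumr_ge0 => i _; rewrite -expr2 sqr_ge0.
Qed.

Lemma normsq_le x (m : R) : (forall k, `|x k ord0| <= m) -> normsq x <= d%:R * m ^+ 2.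
Proof.
move=> xm; rewrite /normsq /dotv -[X in X%:R * _](card_ord d) mulr_natl -sumr_const.
apply: ler_sum => k _; rewrite -expr2 -real_normK ?num_real //.
by rewrite lerXn2r ?nnegrE ?normr_ge0 // (le_trans (normr_ge0 _) (xm k)).
Qed.

(** Up to a positive factor, the signed distance to the mirror between [x] and [y]: positive on the
    side of [x], negative on the side of [y]. *)
Definition side x y z : R := dotv (z - 2^-1 *: (x + y)) (x - y).

Lemma reflectionE x y z :
  reflection x y z = z - (2 * side x y z / normsq (x - y)) *: (x - y).
Proof. by []. Qed.

Lemma sideE x y z : 2 * side x y z = normsq (z - y) - normsq (z - x).
Proof.
rewrite /side /normsq !dotvE (dotvC y z) (dotvC x z) (dotvC y x); by field.
Qed.

Lemma sideB x y z z' : side x y z - side x y z' = dotv (z - z') (x - y).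
Proof. by rewrite /side !dotvE; ring. Qed.

Section Reflection.
Variables x y : E.
Hypothesis xy : x <> y.
Let n0 : normsq (x - y) != 0. Proof. by rewrite gt_eqF // normsqB_gt0. Qed.

(** Reflecting [v] takes it away from [u] when both are on the same side of the mirror, and brings
    it closer when they are on opposite sides. *)
Lemma normsq_reflection u v : normsq (u - reflection x y v) =
  normsq (u - v) + 4 * side x y u * side x y v / normsq (x - y).
Proof.
rewrite reflectionE; set a := 2 * side x y v / normsq (x - y).
have -> : u - (v - a *: (x - y)) = a *: (x - y) + (u - v) by rewrite opprB addrCA.
rewrite normsqZD -sideB /a; by field.
Qed.

Lemma side_reflection z : side x y (reflection x y z) = - side x y z.
Proof.
have := sideB x y (reflection x y z) z.
rewrite reflectionE [_ - _ - z]addrAC subrr add0r dotvNl dotvZl -/(normsq _).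
move=> /eqP; rewrite subr_eq => /eqP ->; by field.
Qed.

Lemma reflectionK : involutive (reflection x y).
Proof.
move=> z; rewrite (reflectionE x y (reflection x y z)) side_reflection reflectionE.
by rewrite mulrN mulNr scaleNr opprK subrK.
Qed.

Lemma reflection_side0 z : side x y z = 0 -> reflection x y z = z.
Proof. by move=> s0; rewrite reflectionE s0 mulr0 mul0r scale0r subr0. Qed.

Lemma reflectionl : reflection x y x = y.
Proof.
have -> : reflection x y x = x - 1 *: (x - y).
  rewrite reflectionE; congr (_ - _ *: _).
  by rewrite sideE subrr normsq0 subr0 divff.
by rewrite scale1r opprB addrC subrK.
Qed.

Lemma reflectionr : reflection x y y = x.
Proof. by have := reflectionK x; rewrite reflectionl. Qed.

Lemma reflection_isometry u v :
  normsq (reflection x y u - reflection x y v) = normsq (u - v).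
Proof.
rewrite normsq_reflection side_reflection (normsqBC (reflection x y u)) normsq_reflection.
by rewrite (normsqBC v); field.
Qed.

Lemma side_left : 0 < side x y x.
Proof.
rewrite -(pmulr_rgt0 (side x y x) (ltr0n R 2)) sideE subrr.
by rewrite normsq0 subr0 normsqB_gt0.
Qed.

Lemma side_right : side x y y < 0.
Proof. by have := side_reflection x; rewrite reflectionl => ->; rewrite oppr_lt0 side_left. Qed.
End Reflection.
End Euclid.

(** * Cells of the attractor and their corners *)

Section IFSBasics.
Variables (R : realType) (d M : nat) (S : similitudes R d M).
Local Notation E := 'cV[R]_d.
Local Notation lam := (Defs.ratio S).
Local Notation V0 := (V0 S).
Local Notation r := (lam^-1 ^+ 2).
Implicit Types (x y p q : E) (w : seq 'I_M).

Lemma ratio_inv_bounds : 0 < lam^-1 < 1.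
Proof.
have l1 := ratio_gt1 S; have l0 : 0 < lam by apply: lt_trans l1.
by rewrite invr_gt0 l0 invf_lt1.
Qed.

Lemma contraction_bounds : 0 < r < 1.
Proof.
have /andP[r0 r1] := ratio_inv_bounds.
by rewrite exprn_gt0 //= expr_lt1 // ltW.
Qed.

Lemma normsq_Psi i x y : normsq (Psi S i x - Psi S i y) = r * normsq (x - y).
Proof.
rewrite /Psi opprD addrACA subrr addr0 -scalerBr -mulmxBr /normsq dotvZl dotvZr.
by rewrite dotv_orthogonal ?rot_orthogonal // mulrA -expr2.
Qed.

Lemma Psiw_cons i w x : Psiw S (i :: w) x = Psi S i (Psiw S w x).
Proof. by []. Qed.

Lemma normsq_Psiw w x y : normsq (Psiw S w x - Psiw S w y) = r ^+ size w * normsq (x - y).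
Proof.
by elim: w => [|i w IH]; [rewrite /= mul1r|rewrite !Psiw_cons normsq_Psi IH (exprS _ (size w)) mulrA].
Qed.

Lemma Psi_inj i : injective (Psi S i). Proof. exact: can_inj (PsiK S i). Qed.

Lemma Psiw_inj w : injective (Psiw S w).
Proof. by elim: w => [|i w IH] x y //; rewrite !Psiw_cons => /Psi_inj /IH. Qed.

Lemma Psiw_cat w w' x : Psiw S (w ++ w') x = Psiw S w (Psiw S w' x).
Proof. by rewrite /Psiw foldr_cat. Qed.

Lemma fixed_point_uniq i p q : Psi S i p = p -> Psi S i q = q -> p = q.
Proof.
move=> pP qP; have /andP[r0 r1] := contraction_bounds.
have := normsq_Psi i p q; rewrite pP qP => /eqP.
rewrite -subr_eq0 -{1}[normsq _]mul1r -mulrBl mulf_eq0 subr_eq0 gt_eqF //=.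
by rewrite normsq_eq0 subr_eq0 => /eqP.
Qed.

Lemma le_card_V0 : le_card V0 M.
Proof.
have /choice[f fP] : forall p : E, exists i : option 'I_M, V0 p -> if i is Some i then Psi S i p = p else False.
  move=> p; case: (pselect (V0 p)) => [[[i ip] _]|]; first by exists (Some i).
  by exists None.
move=> s us sV.
have <- : size [seq Some i | i <- enum 'I_M] = M by rewrite size_map size_enum_ord.
rewrite -(size_map f s); apply: uniq_leq_size.
  rewrite map_inj_in_uniq // => p q /sV /fP + /sV /fP.
  by case: (f p) => // i pi; case: (f q) => // j qj [ij]; rewrite -ij in qj; apply: fixed_point_uniq pi qj.
move=> _ /mapP[p /sV /fP + ->]; case: (f p) => // i _.
by apply: map_f; rewrite mem_enum.
Qed.

Section Attractor.
Variable K : set E.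
Hypothesis attK : attractor S K.

Lemma attractor_Psi i x : K x -> K (Psi S i x).
Proof. by case: attK => _ _ KE Kx; rewrite KE; exists i => //; exists x. Qed.

Lemma attractor_Psiw w x : K x -> K (Psiw S w x).
Proof. by move=> Kx; elim: w => // i w; apply: attractor_Psi. Qed.

Lemma attractor_split n x : K x -> exists w y, [/\ size w = n, K y & x = Psiw S w y].
Proof.
elim: n x => [|n IH] x Kx; first by exists [::], x.
have [_ _ KE] := attK; move: Kx; rewrite {1}KE => -[i _ [y /IH[w [z [sw Kz ->]]] <-]].
by exists (i :: w), z; rewrite /= sw.
Qed.

(** Iterating [Psi S i] from any point of [K] stays in [K] and converges to [p], and [K] is
    closed. *)
Lemma fixed_point_in i p : Psi S i p = p -> K p.
Proof.
move=> pP; case: attK => -[x Kx] cK KE.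
have clK : closed K by apply: compact_closed => //; apply: norm_hausdorff.
apply: contrapT => nKp.
have /nbhs_ballP[eps /= e0 epsP] : nbhs p (~` K).
  by apply: open_nbhs_nbhs; split => //; apply: closed_openC.
have /andP[l0 l1] := ratio_inv_bounds.
have itK n : K (iter n (Psi S i) x) by elim: n => //= n; apply: attractor_Psi.
have itn n : normsq (p - iter n (Psi S i) x) = r ^+ n * normsq (p - x).
  by elim: n => [|n IH] /=; [rewrite mul1r|rewrite -{1}pP normsq_Psi IH (exprS _ n) mulrA].
have li : 1 < lam := ratio_gt1 S.
have li0 : 0 < lam by apply: lt_trans li.
have [n0 /(_ n0 (leqnn _)) h] := expr_unbounded (enorm (p - x) / eps + 1) li.
apply: (epsP (iter n0 (Psi S i) x)) (itK n0); split=> // j k; rewrite ord1.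
rewrite /ball /=; have -> : p j ord0 - iter n0 (Psi S i) x j ord0 = (p - iter n0 (Psi S i) x) j ord0.
  by rewrite !mxE.
apply: le_lt_trans (coord_le_enorm _ _) _.
rewrite /enorm -/(normsq _) itn sqrtrM; last by rewrite exprn_ge0 // sqr_ge0.
rewrite -exprM mulnC exprM sqrtr_sqr ger0_norm ?exprn_ge0 ?(ltW l0) //.
rewrite mulrC exprVn ltr_pdivrMr ?exprn_gt0 //.
rewrite mulrC -ltr_pdivrMr //.
have -> : Num.sqrt (normsq (p - x)) = enorm (p - x) by [].
by apply: lt_le_trans h; rewrite ltrDl.
Qed.

Lemma V0_sub p : V0 p -> K p.
Proof. by move=> [[i ip] _]; apply: fixed_point_in ip. Qed.

Section Nesting.
Hypothesis nestK : nesting S K.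

(** Induction along [w]. If the first map fixes [p], it can be removed; otherwise [p] lies in two
    distinct level-1 cells, and nesting makes the preimage of [p] under the first map a point of
    [V0]. *)
Lemma V0_in_cell p w y : V0 p -> K y -> Psiw S w y = p -> V0 y.
Proof.
move=> + Ky; elim: w p => [|i w IH] p Vp; first by rewrite /= => yp; rewrite yp.
rewrite Psiw_cons => yp; apply: (IH (Psiw S w y)) => //.
have [[j jp] _] := Vp; have [ij|nij] := pselect (i = j).
  suff -> : Psiw S w y = p by [].
  by apply: (@Psi_inj i); rewrite yp ij.
have : (Psi S i @` K `&` Psi S j @` K) p.
  split; last by exists p => //; apply: V0_sub.
  by exists (Psiw S w y) => //; apply: attractor_Psiw.
rewrite nestK // => -[[z Vz zp] _].
by have /Psi_inj <- : Psi S i z = Psi S i (Psiw S w y) by rewrite zp yp.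
Qed.

(** The nesting axiom at every level: apply it at the first letter where the words differ, then
    [V0_in_cell] to the remaining letters. *)
Lemma nesting_words u v x y : size u = size v -> u <> v -> K x -> K y ->
  Psiw S u x = Psiw S v y -> V0 x /\ V0 y.
Proof.
elim: u v => [|i u IH] [|j v] // [suv] nuv Kx Ky; rewrite !Psiw_cons => xy.
have [ij|nij] := pselect (i = j).
  subst j; move/Psi_inj: xy; apply: IH => // uv; apply: nuv; by rewrite uv.
have : (Psi S i @` K `&` Psi S j @` K) (Psi S i (Psiw S u x)).
  split; first by exists (Psiw S u x) => //; apply: attractor_Psiw.
  by exists (Psiw S v y) => //; apply: attractor_Psiw.
rewrite nestK // => -[[z Vz /Psi_inj zx] [z' Vz']].
rewrite xy => /Psi_inj z'y.
by split; [apply: V0_in_cell Vz Kx (esym zx)|apply: V0_in_cell Vz' Ky (esym z'y)].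
Qed.
End Nesting.
End Attractor.
End IFSBasics.

Section Reach.
Local Open Scope nat_scope.
Variables (T : choiceType) (e : rel T).

Lemma reach0 x : reach e x x 0.
Proof. by exists [::]. Qed.

Lemma reach1 x y : e x y -> reach e x y 1.
Proof. by move=> exy; exists [:: y]; rewrite /= exy. Qed.

Lemma reach_leq x y m n : m <= n -> reach e x y m -> reach e x y n.
Proof. by move=> mn [p [ep lp sp]]; exists p; split=> //; apply: leq_trans mn. Qed.

Lemma reach_trans x y z m n : reach e x y m -> reach e y z n -> reach e x z (m + n).
Proof.
move=> [p [ep <- sp]] [q [eq lq sq]]; exists (p ++ q).
by rewrite cat_path ep eq last_cat lq size_cat leq_add.
Qed.

Lemma reach_sym x y n : symmetric e -> reach e x y n -> reach e y x n.
Proof.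
move=> es [p [ep <- sp]]; exists (rev (belast x p)); split.
- by rewrite rev_path; apply: sub_path ep => u v; rewrite es.
- by case: p {ep sp} => //= y' p; rewrite rev_cons last_rcons.
- by rewrite size_rev size_belast.
Qed.

Lemma reach_map (T' : choiceType) (e' : rel T') (f : T -> T') x y n :
  (forall u v, e u v -> e' (f u) (f v)) -> reach e x y n -> reach e' (f x) (f y) n.
Proof.
move=> fe [p [ep <- sp]]; exists (map f p); rewrite size_map last_map; split=> //.
by rewrite path_map; apply: sub_path ep.
Qed.

End Reach.

Lemma reach_bounded (T : choiceType) (e : rel T) (V : T -> Prop) N x y n :
  (forall u v, e u v -> V v) -> V x -> le_card V N -> reach e x y n -> reach e x y N.
Proof.
move=> eV Vx VN [p [ep <- _]].
case/shortenP: ep => p' ep' up' _; exists p'; split=> //.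
suff : (size (x :: p') <= N)%N by apply: ltnW.
apply: VN => // z; rewrite inE => /orP[/eqP ->//|].
move: ep'; clear -eV; elim: p' x => //= u p' IH x /andP[/eV Vu eu].
by rewrite inE => /orP[/eqP ->//|]; apply: IH eu.
Qed.

Lemma reach_refine (T : choiceType) (e e' : rel T) h x y n :
  (forall u v, e u v -> reach e' u v h) -> reach e x y n -> reach e' x y (n * h)%N.
Proof.
move=> ee' [p [ep <- sp]]; apply: (@reach_leq _ _ _ _ (size p * h)); first by rewrite leq_mul2r sp orbT.
elim: p x ep {sp} => [|z p IH] x /=; first by move=> _; apply: reach0.
by move=> /andP[/ee' xz /IH]; rewrite mulSn; apply: reach_trans.
Qed.

Lemma seq_argmin (R : realType) (X : eqType) (f : X -> R) (s : seq X) : s != [::] ->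
  exists2 x, x \in s & forall y, y \in s -> f x <= f y.
Proof.
elim: s => // a s IH _; have [->|/IH[x xs xm]] := eqVneq s [::].
  by exists a; rewrite ?mem_head // => y; rewrite inE => /eqP ->.
have [ax|xa] := leP (f a) (f x).
  exists a; first exact: mem_head.
  by move=> y; rewrite inE => /orP[/eqP ->//|/xm]; apply: le_trans.
exists x; first by rewrite inE xs orbT.
by move=> y; rewrite inE => /orP[/eqP ->|/xm//]; apply: ltW.
Qed.

(** * Reflections and nearest neighbours in [V0] *)

Section NestedFractal.
Variables (R : realType) (d M : nat) (S : similitudes R d M) (K : set 'cV[R]_d).
Hypothesis hK : nested_fractal S K.
Local Notation E := 'cV[R]_d.
Local Notation V0 := (V0 S).
Implicit Types (x y z p q : E) (w : seq 'I_M).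

Lemma attK : attractor S K. Proof. by case: hK. Qed.
Lemma nestK : nesting S K. Proof. by case: hK => _ _ _ _ []. Qed.

Lemma reflection_V0 x y z : V0 x -> V0 y -> x <> y -> V0 z -> V0 (reflection x y z).
Proof.
case: hK => _ _ _ _ [symK _] Vx Vy xy Vz; have [<- _] := symK x y Vx Vy xy.
by exists z.
Qed.

Lemma reflection_cell1 x y w : V0 x -> V0 y -> x <> y -> (0 < size w)%N ->
  exists w', [/\ size w' = size w,
    forall z, K z -> exists2 z', K z' & reflection x y (Psiw S w z) = Psiw S w' z' &
    forall z, V0 z -> exists2 z', V0 z' & reflection x y (Psiw S w z) = Psiw S w' z'].
Proof.
case: hK => _ _ _ _ [symK _] Vx Vy xy w0; have [_ symr] := symK x y Vx Vy xy.
have [s sP] := symr _ w0; have [c b] := sP (in_tuple w).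
exists (s (in_tuple w)); split=> [|z Kz|z Vz]; first by rewrite size_tuple.
  have : (reflection x y @` cell S K (in_tuple w)) (reflection x y (Psiw S w z)).
    by exists (Psiw S w z) => //; exists z.
  by rewrite c => -[z' Kz' <-]; exists z'.
have : (reflection x y @` cell_boundary S (in_tuple w)) (reflection x y (Psiw S w z)).
  by exists (Psiw S w z) => //; exists z.
by rewrite b => -[z' Kz' <-]; exists z'.
Qed.

Lemma reflection_K x y z : V0 x -> V0 y -> x <> y -> K z -> K (reflection x y z).
Proof.
move=> Vx Vy xy /(attractor_split attK 1)[w [z' [sw Kz' ->]]].
have [|w' [sw' wK _]] := @reflection_cell1 x y w Vx Vy xy; first by rewrite sw.
by have [z'' Kz'' ->] := wK _ Kz'; apply: (attractor_Psiw attK).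
Qed.

(** The symmetry axiom concerns levels [r >= 1]. For the empty word, the invariance of [K] follows
    from that of its level-1 cells. *)
Lemma reflection_cell x y w : V0 x -> V0 y -> x <> y ->
  exists w', [/\ size w' = size w,
    forall z, K z -> exists2 z', K z' & reflection x y (Psiw S w z) = Psiw S w' z' &
    forall z, V0 z -> exists2 z', V0 z' & reflection x y (Psiw S w z) = Psiw S w' z'].
Proof.
move=> Vx Vy xy; case: w => [|i w]; last exact: reflection_cell1.
exists [::]; split=> // z; [move=> /(reflection_K Vx Vy xy)|move=> /(reflection_V0 Vx Vy xy)];
  by exists (reflection x y z).
Qed.

Lemma V0_two : exists x y, [/\ V0 x, V0 y & x <> y].
Proof.
case: hK => _ /pcard_leP[f] _ _ _.
have I0 : `I_2 0%N by []. have I1 : `I_2 1%N by [].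
exists (f 0%N), (f 1%N); split; try exact: funS.
by move/(inj (mem_set I0) (mem_set I1)).
Qed.

Lemma V0_enum : exists s : seq E, [/\ uniq s, forall x, x \in s <-> V0 x & (size s <= M)%N].
Proof. exact: le_card_enum (@le_card_V0 _ _ _ S). Qed.

Lemma ler_enorm (x y : E) : (enorm x <= enorm y) = (normsq x <= normsq y).
Proof. by rewrite /enorm ler_sqrt // normsq_ge0. Qed.

Definition nn p q : Prop := [/\ V0 p, V0 q, p <> q & enorm (p - q) = delta0 S].

Lemma nn_exists : exists p q, nn p q /\
  forall x y, V0 x -> V0 y -> x <> y -> delta0 S <= enorm (x - y).
Proof.
have [s [_ sV _]] := V0_enum; have [x0 [y0 [Vx0 Vy0 xy0]]] := V0_two.
pose l := [seq a <- [seq (a, b) | a <- s, b <- s] | a.1 != a.2].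
have lP (a : E * E) : a \in l <-> [/\ V0 a.1, V0 a.2 & a.1 <> a.2].
  rewrite mem_filter; split.
    by move=> /andP[/eqP ab /allpairsP[[u v] /= [/sV ? /sV ? E]]]; rewrite E in ab *.
  case: a => a b /= [/sV ? /sV ? /eqP ->] /=.
  by apply/allpairsP; exists (a, b).
have [|[p q] /lP /= [Vp Vq pq] pqm] := @seq_argmin R _ (fun a : E * E => enorm (a.1 - a.2)) l.
  have : (x0, y0) \in l by apply/lP.
  by case: (l).
have lb : lbound [set enorm (a.1 - a.2) | a in
        [set a : E * E | [/\ V0 a.1, V0 a.2 & a.1 <> a.2]]] (enorm (p - q)).
  by move=> _ [a [? ? ?] <-]; apply: pqm; apply/lP.
have ne : [set enorm (a.1 - a.2) | a in
        [set a : E * E | [/\ V0 a.1, V0 a.2 & a.1 <> a.2]]] !=set0.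
  by exists (enorm (p - q)); exists (p, q).
have dE : enorm (p - q) = delta0 S.
  apply/eqP; rewrite eq_le lb_le_inf //=; apply: ge_inf; first by exists (enorm (p - q)).
  by exists (p, q).
exists p, q; split=> // x y Vx Vy xy; rewrite -dE; apply: lb.
by exists (x, y).
Qed.

Lemma nn_min p q x y : nn p q -> V0 x -> V0 y -> x <> y -> normsq (p - q) <= normsq (x - y).
Proof.
move=> [_ _ _ pq] Vx Vy xy; rewrite -ler_enorm pq.
by have [? [? [_ h]]] := nn_exists; apply: h.
Qed.

Lemma nn_closest p q x y : nn p q -> V0 x -> V0 y -> x <> y -> normsq (x - y) <= normsq (p - q) ->
  nn x y.
Proof.
move=> [_ _ _ pq] Vx Vy xy; rewrite -ler_enorm pq => xyd; split=> //.
have [? [? [_ h]]] := nn_exists.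
by apply/eqP; rewrite eq_le xyd h.
Qed.

Lemma nn_sym p q : nn p q -> nn q p.
Proof.
move=> nnpq; have [Vp Vq pq _] := nnpq.
by apply: (nn_closest nnpq) => //; [apply: nesym|rewrite normsqBC].
Qed.

Lemma nn_reflection x y p q : V0 x -> V0 y -> x <> y -> nn p q ->
  nn (reflection x y p) (reflection x y q).
Proof.
move=> Vx Vy xy nnpq; have [Vp Vq pq _] := nnpq.
apply: (nn_closest nnpq); rewrite ?reflection_isometry //; try exact: reflection_V0.
by move=> /(can_inj (reflectionK xy)).
Qed.

(** A reflection that takes one point of a closest pair to [x] carries the other to a nearest
    neighbour of [x]. *)
Lemma nn_neighbor x : V0 x -> exists y, nn x y.
Proof.
move=> Vx; have [p [q [nnpq _]]] := nn_exists; have [Vp Vq pq _] := nnpq.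
have [->|px] := pselect (x = p); first by exists q.
exists (reflection p x q); rewrite -{1}(reflectionl (nesym px)).
by apply: nn_reflection => //; apply: nesym.
Qed.

Definition nnb : rel E := fun p q => `[< nn p q >].

Lemma nnb_sym : symmetric nnb.
Proof. by move=> p q; apply/asboolP/asboolP => /nn_sym. Qed.

Let linked x y := exists n, reach nnb x y n.

Let linked_trans x y z : linked x y -> linked y z -> linked x z.
Proof. by move=> [m h] [n h']; exists (m + n)%N; apply: reach_trans h h'. Qed.

Let linked_nn x y : nn x y -> linked x y.
Proof. by move=> /asboolP h; exists 1%N; apply: reach1. Qed.

(* In a closest pair of points x, y of different components, replacing x by its
   mirror image in the bisector of y and a nearest neighbour x' of x gives a
   closer such pair. *)
Lemma V0_linked x y : V0 x -> V0 y -> linked x y.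
Proof.
move=> Vx Vy; apply: contrapT => nxy.
have [s [_ sV _]] := V0_enum.
pose l := [seq a <- [seq (a, b) | a <- s, b <- s] | ~~ `[< linked a.1 a.2 >]].
have lP (a : E * E) : a \in l <-> [/\ V0 a.1, V0 a.2 & ~ linked a.1 a.2].
  rewrite mem_filter; split.
    by move=> /andP[/asboolPn ab /allpairsP[[u v] /= [/sV ? /sV ? E]]]; rewrite E in ab *.
  case: a => a b /= [/sV ? /sV ? nab]; apply/andP; split; first exact/asboolPn.
  by apply/allpairsP; exists (a, b).
have [|[a b] /lP /= [Va Vb nab] abm] := @seq_argmin R _ (fun a : E * E => normsq (a.1 - a.2)) l.
  have : (x, y) \in l by apply/lP.
  by case: (l).
have {}abm a' b' : V0 a' -> V0 b' -> ~ linked a' b' -> normsq (a - b) <= normsq (a' - b').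
  by move=> *; apply: (abm (a', b')); apply/lP.
have ab : a <> b by move=> ab; apply: nab; rewrite ab; exists 0%N; apply: reach0.
have [a' naa'] := nn_neighbor Va; have [_ Va' aa' _] := naa'.
have a'b : a' <> b by move=> a'b; apply: nab; rewrite -a'b; apply: linked_nn.
have h1 : normsq (a - b) <= normsq (a' - b).
  apply: abm => // a'lb; apply: nab; apply: linked_trans a'lb; exact: linked_nn.
(* The mirror image of [a] is a nearest neighbour of [b], which is the image of [a']; so it lies in
   the component of [b]. *)
have h2 : normsq (a - b) <= normsq (a - reflection a' b a).
  apply: abm => //; first exact: reflection_V0.
  move=> lk; apply: nab; apply: linked_trans lk _; apply: linked_nn.
  by rewrite -{2}(reflectionl a'b); apply: nn_reflection.
have h3 : normsq (a - a') <= normsq (a - b) by apply: (nn_min naa').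
have h4 : 0 < normsq (a - a') by apply: normsqB_gt0.
have h5 : 0 < normsq (a' - b) by apply: normsqB_gt0.
(* The squared distance from [a] to its image is [(|a-b|^2 - |a-a'|^2)^2 / |a'-b|^2]. It is less
   than [|a-b|^2], because [0 < |a-a'|^2 <= |a-b|^2 <= |a'-b|^2]. *)
move: h2; rewrite normsq_reflection // subrr normsq0 add0r ler_pdivlMr //.
have := sideE a' b a; set t := side a' b a => tE.
have -> : 4 * t * t = (2 * t) ^+ 2 by ring.
rewrite tE; apply/negP; rewrite -ltNge; nra.
Qed.

Lemma V0_reach : exists b0, forall x y, V0 x -> V0 y -> reach nnb x y b0.
Proof.
exists M => x y Vx Vy; have [n h] := V0_linked Vx Vy.
by apply: (reach_bounded _ Vx (@le_card_V0 _ _ _ S) h) => u v /asboolP[].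
Qed.
End NestedFractal.

Section Continuity.
Variables (R : realType) (d : nat).
Local Notation E := 'cV[R]_d.

(** The hypothesis is Euclidean but the topology comes from the sup norm; the radius [eps / (d + 1)]
    makes up for the factor [sqrt d] between the norms. *)
Lemma nonexpansive_continuous (f : E -> E) :
  (forall x y, normsq (f x - f y) <= normsq (x - y)) -> continuous f.
Proof.
move=> fle x A /nbhs_ballP[eps /= eps0 epsA].
have d1 : 0 < d.+1%:R :> R by [].
have dl0 : 0 < eps / d.+1%:R by apply: divr_gt0.
apply/nbhs_ballP; exists (eps / d.+1%:R) => //= y yx; apply: epsA; split=> // j k; rewrite ord1 /ball /=.
have -> : f x j ord0 - f y j ord0 = (f x - f y) j ord0 by rewrite !mxE.
apply: le_lt_trans (coord_le_enorm _ _) _.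
rewrite -(ltr_pXn2r (_ : (0 < 2)%N)) ?nnegrE ?sqrtr_ge0 ?(ltW eps0) // enorm_sqr.
apply: le_lt_trans (fle _ _) _.
have h : normsq (x - y) <= d%:R * (eps / d.+1%:R) ^+ 2.
  apply: normsq_le => i; case: yx => _ /(_ i ord0); rewrite /ball /= => /ltW.
  by rewrite !mxE.
apply: le_lt_trans h _.
rewrite expr_div_n mulrA ltr_pdivrMr ?exprn_gt0 // mulrC ltr_pM2l ?exprn_gt0 //.
by rewrite -natrX ltr_nat; nia.
Qed.

Lemma dotv_continuous (a v : E) : continuous (fun x : E => dotv (x - a) v).
Proof.
move=> x A /nbhs_ballP[eps /= eps0 epsA].
pose s := \sum_k `|v k ord0|; have s0 : 0 <= s by apply: sumr_ge0.
have dl0 : 0 < eps / (s + 1) by apply: divr_gt0 => //; lra.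
apply/nbhs_ballP; exists (eps / (s + 1)) => //= y yx; apply: epsA; rewrite /ball /=.
have -> : dotv (x - a) v - dotv (y - a) v = dotv (x - y) v by rewrite !dotvE; ring.
apply: le_lt_trans (ler_norm_sum _ _ _) _.
apply: (@le_lt_trans _ _ (\sum_k (eps / (s + 1)) * `|v k ord0|)).
  apply: ler_sum => i _; rewrite normrM ler_wpM2r //.
  by case: yx => _ /(_ i ord0); rewrite /ball /= => /ltW; rewrite !mxE.
rewrite -mulr_sumr -/s mulrAC ltr_pdivrMr; last lra.
by rewrite ltr_pM2l //; lra.
Qed.

Lemma side_continuous (x y : E) : continuous (side x y).
Proof. exact: dotv_continuous. Qed.
End Continuity.

Section NestedFractal.
Variables (R : realType) (d M : nat) (S : similitudes R d M) (K : set 'cV[R]_d).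
Hypothesis hK : nested_fractal S K.
Local Notation E := 'cV[R]_d.
Local Notation V0 := (V0 S).
Local Notation nn := (nn S).
Local Notation nnb := (nnb S).
Local Notation attK := (attK hK).
Local Notation nestK := (nestK hK).
Implicit Types (x y z p q : E) (w : seq 'I_M).

(* F_k before its blow-up by the k-fold inverse of Psi_0. *)
Definition ek (k : nat) : rel E := fun u v => `[< exists w p q,
  [/\ size w = k, nn p q, u = Psiw S w p & v = Psiw S w q] >].

Definition vert (k : nat) (z : E) : Prop := exists w p, [/\ size w = k, V0 p & z = Psiw S w p].

Lemma ek_sym k : symmetric (ek k).
Proof.
move=> u v; apply/asboolP/asboolP => -[w [p [q [sw pq up vq]]]]; exists w, q, p;
  by split=> //; apply: (nn_sym hK).
Qed.

Lemma ek_vert k u v : ek k u v -> vert k v.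
Proof. by move=> /asboolP[w [p [q [sw [_ Vq _ _] _ ->]]]]; exists w, q. Qed.

Lemma ek_Psiw w k u v : ek k u v -> ek (size w + k) (Psiw S w u) (Psiw S w v).
Proof.
move=> /asboolP[w' [p [q [sw pq -> ->]]]]; apply/asboolP; exists (w ++ w'), p, q.
by rewrite size_cat sw !Psiw_cat.
Qed.

Lemma ek0 u v : ek 0 u v = nnb u v.
Proof.
apply/asboolP/asboolP => [[w [p [q [/size0nil -> pq -> ->]]]] //|uv].
by exists [::], u, v.
Qed.

(** The reflection permutes the boundaries of the cells and preserves distances, so it takes nearest
    corners of a cell to nearest corners of a cell. *)
Lemma ek_reflection k x y u v : V0 x -> V0 y -> x <> y -> ek k u v ->
  ek k (reflection x y u) (reflection x y v).
Proof.
move=> Vx Vy xy /asboolP[w [p [q [sw pq -> ->]]]]; have [Vp Vq npq _] := pq.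
have [w' [sw' _ wV]] := reflection_cell hK w Vx Vy xy.
have [[p' Vp' pE] [q' Vq' qE]] := (wV p Vp, wV q Vq).
apply/asboolP; exists w', p', q'; split=> //; first by rewrite sw'.
apply: (nn_closest hK pq) => //.
  move=> p'q'; apply: npq; apply: (@Psiw_inj _ _ _ S w).
  by apply: (can_inj (reflectionK xy)); rewrite pE qE p'q'.
have := reflection_isometry xy (Psiw S w p) (Psiw S w q).
rewrite pE qE !normsq_Psiw sw' => /mulfI ->//.
have /andP[r0 _] := contraction_bounds S; by rewrite expf_neq0 // gt_eqF.
Qed.

Lemma le_card_vert k : le_card (vert k) (M ^ k * M).
Proof.
elim: k => [|k IH].
  rewrite mul1n; apply: le_card_sub (@le_card_V0 _ _ _ S) => z.
  by move=> [w [p [/size0nil -> Vp ->]]].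
have -> : (M ^ k.+1 * M = \sum_(i < M) M ^ k * M)%N by rewrite sum_nat_const card_ord expnS mulnA.
pose Pi (i : nat) z := exists j : 'I_M, i = j :> nat /\ exists2 y, vert k y & z = Psi S j y.
apply: (@le_card_bigcup _ Pi _ _ (fun=> M ^ k * M)%N).
  move=> z [[|j w] [p [//]]] [sw] Vp ->; exists j => //; exists j; split=> //.
  by exists (Psiw S w p) => //; exists w, p.
move=> i iM; apply: (le_card_inj (f := Psi_inv S (Ordinal iM)) _ _ IH).
  by move=> x y _ _ /(can_inj (Psi_invK S (Ordinal iM))).
move=> z [j [ij [y yk ->]]]; have -> : j = Ordinal iM by apply: val_inj.
by rewrite PsiK.
Qed.

Lemma vert_K k z : vert k z -> K z.
Proof. by move=> [w [p [_ Vp ->]]]; apply: (attractor_Psiw attK); apply: (V0_sub attK). Qed.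

Definition cellmates : rel E := fun u v => `[< exists i p q,
  [/\ V0 p, V0 q, u = Psi S i p & v = Psi S i q] >].

Lemma closed_cells (A : set 'I_M) : closed (\bigcup_(i in A) (Psi S i @` K)).
Proof.
apply: closed_bigcup => [|i _]; first exact: finite_finset.
apply: compact_closed; first exact: norm_hausdorff.
apply: continuous_compact; last by case: attK.
apply: continuous_subspaceT; apply: nonexpansive_continuous => x y.
rewrite normsq_Psi ler_piMl ?normsq_ge0 //.
by have /andP[_ /ltW] := contraction_bounds S.
Qed.

Lemma connectedK : connected K. Proof. by case: hK. Qed.

Lemma V0_vert1 x : V0 x -> vert 1 x.
Proof. by move=> Vx; have [[i ix] _] := Vx; exists [:: i], x; rewrite /Psiw /= ix. Qed.

Lemma vert1E u : vert 1 u -> exists i p, V0 p /\ u = Psi S i p.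
Proof. by move=> [[|i [|? ?]] [p [] // _ Vp ->]]; exists i, p. Qed.

(** Connectedness of [K]: the cells with a corner reachable from [u] and the remaining cells form
    two closed sets. By nesting, a common point would be a corner of both, hence reachable. So the
    first family covers [K]. *)
Lemma cellmates_reach u v : vert 1 u -> vert 1 v -> reach cellmates u v (M ^ 1 * M).
Proof.
move=> Vu Vv; suff [n h] : exists n, reach cellmates u v n.
  apply: (reach_bounded _ Vu (@le_card_vert 1) h) => a b /asboolP[i [p [q [_ Vq _ ->]]]].
  by exists [:: i], q.
have [i [p [Vp uE]]] := vert1E Vu; have [j [q [Vq vE]]] := vert1E Vv.
pose A := [set l | exists n, exists2 q, V0 q & reach cellmates u (Psi S l q) n].
have Ai : A i.
  by exists 0%N, p => //; rewrite uE; apply: reach0.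
have AK : \bigcup_(l in A) (Psi S l @` K) = K.
  apply: connectedK.
  - by exists (Psi S i p); exists i => //; exists p => //; apply: (V0_sub attK).
  - exists (~` (\bigcup_(l in ~` A) (Psi S l @` K))).
      exact/closed_openC/closed_cells.
    apply/seteqP; split=> x.
      move=> [l [n [q' Vq' uq']] [y Ky <-]]; split; first exact: (attractor_Psi attK).
      move=> [l' nAl' [y' Ky' xE]]; have [ll'|nll'] := pselect (l = l').
        by apply: nAl'; rewrite -ll'; exists n, q'.
      have : (Psi S l @` K `&` Psi S l' @` K) (Psi S l y).
        by split; [exists y|exists y'].
      rewrite nestK // => -[[z Vz zE] [z' Vz' z'E]]; apply: nAl'.
      exists (n + 1)%N, z' => //; apply: reach_trans uq' _; apply: reach1.
      by apply/asboolP; exists l, q', z; rewrite z'E zE.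
    move=> [Kx nx]; have [_ _ KE] := attK; move: (Kx); rewrite {1}KE => -[l _ lx].
    exists l => //; apply: contrapT => nAl; apply: nx; exists l => //.
  - exists (\bigcup_(l in A) (Psi S l @` K)); first exact: closed_cells.
    apply/seteqP; split=> x; last by case.
    move=> h; split=> //; case: h => l _ [y Ky <-]; exact: (attractor_Psi attK).
have : K v by apply: (vert_K Vv).
rewrite -{1}AK => -[l [n [q' Vq' uq']] [y Ky yv]].
have [lj|nlj] := pselect (l = j).
  exists (n + 1)%N; apply: reach_trans uq' _; apply: reach1; apply/asboolP.
  by exists l, q', q; rewrite vE lj.
have : (Psi S l @` K `&` Psi S j @` K) v.
  by split; [exists y|exists q => //; apply: (V0_sub attK)].
rewrite nestK // => -[[z Vz zE] _].
exists (n + 1)%N; apply: reach_trans uq' _; apply: reach1; apply/asboolP.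
by exists l, q', z.
Qed.

Lemma cellmates_reach_ek k h : (forall x y, V0 x -> V0 y -> reach (ek k) x y h) ->
  forall u v, cellmates u v -> reach (ek k.+1) u v h.
Proof.
move=> hk u v /asboolP[i [p [q [Vp Vq -> ->]]]].
apply: (reach_map _ (hk p q Vp Vq)) => a b; exact: (@ek_Psiw [:: i]).
Qed.

Lemma corners_reach k : exists h, forall x y, V0 x -> V0 y -> reach (ek k) x y h.
Proof.
elim: k => [|k [h hk]].
  have [b0 b0P] := V0_reach hK; exists b0 => x y Vx Vy.
  by apply: (@reach_map _ nnb _ (ek 0) id _ _ _ _ (b0P x y Vx Vy)) => u v; rewrite ek0.
exists (M ^ 1 * M * h)%N => x y Vx Vy; apply: reach_refine (cellmates_reach_ek hk) _.
by apply: cellmates_reach; apply: V0_vert1.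
Qed.
End NestedFractal.

(** * Folding paths along mirrors, and the crossing distance *)

Section Folding.
Variables (R : realType) (d M : nat) (S : similitudes R d M) (K : set 'cV[R]_d).
Hypothesis hK : nested_fractal S K.
Hypothesis hS : one_point_intersection S.
Local Notation E := 'cV[R]_d.
Local Notation V0 := (V0 S).
Local Notation nn := (nn S).
Local Notation ek := (ek S).
Local Notation attK := (attK hK).
Local Notation nestK := (nestK hK).
Implicit Types (x y z p q : E) (w : seq 'I_M).

(** By the third hypothesis, the weak and the strict inequalities cut out the same part of [K],
    which is therefore open, closed and nonempty in [K]. *)
Lemma connected_sides (f g : E -> R) : continuous f -> continuous g ->
  (forall z, K z -> 0 <= f z -> g z <= 0 -> 0 < f z /\ g z < 0) ->
  (exists2 z, K z & 0 <= f z /\ g z <= 0) -> forall z, K z -> 0 < f z /\ g z < 0.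
Proof.
move=> cf cg fg [z0 Kz0 [fz0 gz0]] z Kz.
have KE : K `&` [set z | 0 <= f z] `&` [set z | g z <= 0] = K.
  apply: (connectedK hK).
  - by exists z0.
  - exists ([set z | 0 < f z] `&` [set z | g z < 0]).
      apply: openI.
        by apply: (@open_comp _ _ f [set t | 0 < t]) => [? _|]; [apply: cf|apply: open_gt].
      by apply: (@open_comp _ _ g [set t | t < 0]) => [? _|]; [apply: cg|apply: open_lt].
    apply/seteqP; split=> t /=; first by move=> [[Kt ft] gt]; have [] := fg t Kt ft gt.
    by move=> [Kt [/ltW ft /ltW gt]].
  exists ([set z | 0 <= f z] `&` [set z | g z <= 0]); last by rewrite setIA.
  apply: closedI.
    by apply: (closed_comp (f := f) (D := [set t | 0 <= t])) => [? _|]; [apply: cf|apply: closed_ge].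
  by apply: (closed_comp (f := g) (D := [set t | t <= 0])) => [? _|]; [apply: cg|apply: closed_le].
by move: (Kz); rewrite -{1}KE => -[[_ fz] gz]; apply: fg.
Qed.

(* A corner cannot cut K in such a way that both sides contain corners. Otherwise,
   the mirror image of the cut at a second corner would have a side contained in
   one of the sides of the first cut, and with fewer corners. *)
Lemma no_cut_corner r (g : E -> R) : V0 r -> continuous g ->
  (forall y, K y -> g y = 0 -> y = r) ->
  (exists2 a, V0 a & g a < 0) -> (exists2 b, V0 b & 0 < g b) -> False.
Proof.
have [s [us sV _]] := V0_enum S.
have [n] := ubnP (count (fun y => g y < 0) s).
elim: n r g => // n IH r g; rewrite ltnS => cn Vr cg gr [a Va ga] [b Vb gb].
have Kr := V0_sub attK Vr.
have gr0 : g r = 0.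
  apply: contrapT => gr0.
  have nz y : K y -> g y <> 0 by move=> Ky gy; apply: gr0; rewrite -(gr y Ky gy).
  (* The constant -1 makes the condition on the second function void: if [g] had no zero on [K], it
     would be positive on all of [K]. *)
  have cc : continuous (fun _ : E => -1 : R) by apply: cst_continuous.
  have H1 z : K z -> 0 <= g z -> (-1 : R) <= 0 -> 0 < g z /\ (-1 : R) < 0.
    move=> Kz gz _; split; last lra.
    by move: gz; rewrite le_eqVlt => /orP[/eqP /esym /(nz z Kz)|].
  have H2 : exists2 z, K z & 0 <= g z /\ (-1 : R) <= 0.
    by exists b; [apply: V0_sub attK _ Vb|split; [apply: ltW|lra]].
  by have [ga' _] := connected_sides cg cc H1 H2 (V0_sub attK Va); lra.
have ra : r <> a by move=> ra; move: ga; rewrite -ra gr0 ltxx.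
pose rf := reflection r a; pose g' y := - g (rf y).
have cg' : continuous g'.
  move=> y; apply: continuousN; apply: (@continuous_comp _ _ _ rf g); last exact: cg.
  by apply: nonexpansive_continuous => u v; rewrite reflection_isometry.
have g'r : 0 < g' r by rewrite /g' /rf reflectionl // oppr_gt0.
have g'a y : K y -> g' y = 0 -> y = a.
  move=> Ky /eqP; rewrite oppr_eq0 => /eqP g0.
  have h : rf y = r by apply: gr g0; apply: (reflection_K hK).
  by rewrite -(reflectionK ra y) -/rf h /rf reflectionl.
apply: (IH a g') => //.
- apply: leq_trans cn; rewrite -!size_filter.
  (* The corner [a] is lost since [g' a = 0], and every corner with [g' < 0] also has [g < 0]. *)
  have : leq (size (a :: [seq y <- s | g' y < 0])) (size [seq y <- s | g y < 0]); last by [].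
  apply: uniq_leq_size.
    by rewrite /= filter_uniq // mem_filter /g' /rf reflectionr // gr0 oppr0 ltxx.
  move=> y; rewrite inE => /orP[/eqP ->|]; rewrite !mem_filter; first by rewrite ga; apply/sV.
  move=> /andP[g'y ys]; rewrite ys andbT ltNge; apply/negP => gy.
  (* Otherwise the region [g >= 0], [g' <= 0] meets [K], so it is all of [K], contrary to
     [g' r > 0]. *)
  have H1 z : K z -> 0 <= g z -> g' z <= 0 -> 0 < g z /\ g' z < 0.
    move=> Kz; rewrite le_eqVlt => /orP[/eqP /esym /(gr z Kz) ->|gz].
      by move=> h; move: g'r; rewrite ltNge h.
    rewrite le_eqVlt => /orP[/eqP /(g'a z Kz) zE|//].
    by move: gz; rewrite zE => /lt_trans /(_ ga); rewrite ltxx.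
  have H2 : exists2 z, K z & 0 <= g z /\ g' z <= 0.
    by exists y; [apply: (V0_sub attK); apply/sV|split=> //; apply: ltW].
  by have [_ /lt_trans /(_ g'r)] := connected_sides cg cg' H1 H2 Kr; rewrite ltxx.
- exists (rf b); first exact: (reflection_V0 hK).
  by rewrite /g' /rf reflectionK // oppr_lt0.
- by exists r.
Qed.

(* An edge crossing the mirror is mapped to itself: otherwise its cell would meet the
   mirror in a single corner, cutting that cell. *)
Lemma edge_across k x y u v : V0 x -> V0 y -> x <> y -> ek k u v ->
  0 < side x y u -> side x y v < 0 -> u = reflection x y v.
Proof.
move=> Vx Vy xy /asboolP[w [p [q [sw pq uE vE]]]] su sv; have [Vp Vq npq _] := pq.
have [w' [sw' wK wV]] := reflection_cell hK w Vx Vy xy.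
(* If the mirror preserves the cell, the image of [v] is a corner of it. Were it different from [u],
   it would be at least as far from [u] as [v] is; but [u] and [v] are on opposite sides, so it is
   closer. *)
have [ww'|nww'] := pselect (w = w').
  have [q' Vq' qE] := wV q Vq.
  apply: contrapT => uv; have npq' : p <> q'.
    by move=> pq'; apply: uv; rewrite uE vE qE -ww' pq'.
  have h1 := nn_min hK pq Vp Vq' npq'.
  have /andP[r0 _] := contraction_bounds S.
  have : normsq (u - v) <= normsq (u - reflection x y v).
    by rewrite uE vE qE -ww' !normsq_Psiw ler_wpM2l // exprn_ge0 // ltW.
  rewrite normsq_reflection // lerDl pmulr_lge0 ?invr_gt0 ?normsqB_gt0 //.
  by rewrite leNgt nmulr_llt0 // mulr_gt0.
exfalso; pose g z := side x y (Psiw S w z).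
(* A point of the cell on the mirror is fixed, so it also lies in the image cell; nesting makes it a
   corner of both. By one-point intersection there is at most one such point. *)
have zero z : K z -> g z = 0 -> cell_boundary S w (Psiw S w z) /\ cell_boundary S w' (Psiw S w z).
  move=> Kz gz; have [z' Kz' zE] := wK z Kz.
  rewrite reflection_side0 // in zE.
  have [Vz Vz'] := nesting_words attK nestK (esym sw') nww' Kz Kz' zE.
  by split; [exists z|exists z'].
have one z z' : K z -> g z = 0 -> K z' -> g z' = 0 -> z = z'.
  move=> Kz gz Kz' gz'; have [hz1 hz2] := zero z Kz gz; have [hz'1 hz'2] := zero z' Kz' gz'.
  have /pcard_leP[f] := hS nww' (esym sw').
  have fz t : (cell_boundary S w `&` cell_boundary S w') t -> f t = 0%N.
    by move=> /(@funS _ _ _ _ f) /=; case: (f t).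
  apply: (@Psiw_inj _ _ _ S w); apply: (@inj _ _ _ f); rewrite ?inE //.
  exact: etrans (fz _ (conj hz1 hz2)) (esym (fz _ (conj hz'1 hz'2))).
have cg : continuous g.
  move=> z; apply: (@continuous_comp _ _ _ (Psiw S w) (side x y)); last exact: side_continuous.
  apply: nonexpansive_continuous => a b; rewrite normsq_Psiw ler_piMl ?normsq_ge0 //.
  by have /andP[/ltW r0 /ltW r1] := contraction_bounds S; rewrite exprn_ile1.
have [r Vr rP] : exists2 r, V0 r & forall z, K z -> g z = 0 -> z = r.
  have [[r [Kr gr]]|nr] := pselect (exists r, K r /\ g r = 0).
    exists r; last by move=> z Kz gz; apply: one.
    have [h _] := zero r Kr gr; case: h => r' Vr' /Psiw_inj <- //.
  by exists p => // z Kz gz; case: nr; exists z.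
apply: (no_cut_corner Vr cg rP); first by exists q => //; rewrite /g -vE.
by exists p => //; rewrite /g -uE.
Qed.

Lemma fold_path k x y u (p : seq E) : V0 x -> V0 y -> x <> y -> path (ek k) u p -> last u p = y ->
  0 <= side x y u -> reach (ek k) u x (size p).
Proof.
move=> Vx Vy xy; have refl_reach v (p' : seq E) : path (ek k) v p' -> last v p' = y ->
    reach (ek k) (reflection x y v) x (size p').
  move=> ep' lp'.
  have := reach_map (e := ek k) (fun a b => @ek_reflection _ _ _ _ _ hK k x y a b Vx Vy xy).
  move=> /(_ v y (size p')); rewrite reflectionr //; apply; by exists p'.
elim: p u => [|v p IH] u /=; first by move=> _ ->; rewrite leNgt side_right.
move=> /andP[uv ep] lp; rewrite le_eqVlt => /orP[/eqP su|su].
  have := refl_reach u (v :: p); rewrite reflection_side0 //=; apply=> //.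
  by rewrite uv.
have [sv|sv] := leP 0 (side x y v).
  by rewrite -[(size p).+1]add1n; apply: reach_trans (reach1 uv) _; apply: IH.
rewrite (edge_across Vx Vy xy uv su sv); apply: reach_leq (leqnSn _) _.
exact: refl_reach.
Qed.

(** As [z] is a nearest neighbour, [x] is no farther from [z] than from [y], so the path can be
    folded along the bisector of [z] and [y]. *)
Lemma reach_nn k x y z n : V0 x -> V0 y -> x <> y -> reach (ek k) x y n -> nn x z ->
  reach (ek k) x z n.
Proof.
move=> Vx Vy xy [p [ep lp sp]] xz; have [_ Vz nxz _] := xz.
have [zy|zy] := pselect (z = y); first by exists p; rewrite zy.
apply: reach_leq sp _; apply: (fold_path Vz Vy zy ep lp).
rewrite -(pmulr_rge0 _ (ltr0n R 2)) sideE subr_ge0.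
exact: (nn_min hK xz Vx Vy xy).
Qed.

Lemma reach_corner k x y x' n : V0 x -> V0 y -> x <> y -> V0 x' -> reach (ek k) x y n ->
  exists y', [/\ V0 y', x' <> y' & reach (ek k) x' y' n].
Proof.
move=> Vx Vy xy Vx' h; have [<-|xx'] := pselect (x = x'); first by exists y.
exists (reflection x x' y); split; first exact: (reflection_V0 hK).
  by rewrite -{1}(reflectionl xx') => /(can_inj (reflectionK xx')).
have := reach_map (e := ek k) (fun a b => @ek_reflection _ _ _ _ _ hK k x x' a b Vx Vx' xx').
by move=> /(_ x y n h); rewrite reflectionl.
Qed.

Let crossing k n := `[< exists x y, [/\ V0 x, V0 y, x <> y & reach (ek k) x y n] >].

Let crossing_ex k : exists n, crossing k n.
Proof.
have [x [y [Vx Vy xy]]] := V0_two hK; have [h hP] := corners_reach hK k.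
by exists h; apply/asboolP; exists x, y; split=> //; apply: hP.
Qed.

(** The least graph distance at level [k] between distinct points of [V0]; by [rho_nn], all nearest
    neighbours realize it. *)
Definition rho k : nat := ex_minn (crossing_ex k).

Lemma rho_le k x y n : V0 x -> V0 y -> x <> y -> reach (ek k) x y n -> (rho k <= n)%N.
Proof.
move=> Vx Vy xy h; rewrite /rho; case: ex_minnP => m _; apply.
by apply/asboolP; exists x, y.
Qed.

Lemma rho_nn k x z : nn x z -> reach (ek k) x z (rho k).
Proof.
move=> xz; have [Vx _ _ _] := xz.
rewrite /rho; case: ex_minnP => m /asboolP[a [b [Va Vb ab h]]] _.
have [y [Vy xy h']] := reach_corner Va Vb ab Vx h.
exact: reach_nn h' xz.
Qed.

(** A chain of nearest neighbours joins any two points of [V0], and its length does not depend on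
    [k]. *)
Lemma corners_reach_rho : exists b0, forall k x y, V0 x -> V0 y ->
  reach (ek k) x y (b0 * rho k).
Proof.
have [b0 b0P] := V0_reach hK; exists b0 => k x y Vx Vy.
by apply: reach_refine (b0P x y Vx Vy) => u v /asboolP; apply: rho_nn.
Qed.
End Folding.

Lemma first_visit (T : eqType) (P : T -> Prop) (a : T) (p : seq T) :
  (0 < size p)%N -> P (last a p) -> exists p1 p2,
  [/\ p = p1 ++ p2, (0 < size p1)%N, avoids P a p1 & P (last a p1)].
Proof.
elim: p a => // b p IH a _ /=; have [Pb|nPb] := pselect (P b).
  by exists [:: b], p.
case: p IH => [_|c p IH]; first by move=> /nPb.
move=> /(IH b isT)[p1 [p2 [-> sp1 ap1 lp1]]].
exists (b :: p1), p2; split=> // x; case: p1 sp1 ap1 {lp1} => //= c' p1 _ ap1.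
by rewrite inE => /orP[/eqP ->//|/ap1].
Qed.

(** * Growth of the crossing distance with the level *)

Section Growth.
Variables (R : realType) (d M : nat) (S : similitudes R d M) (K : set 'cV[R]_d).
Hypothesis hK : nested_fractal S K.
Hypothesis hS : one_point_intersection S.
Local Notation E := 'cV[R]_d.
Local Notation lam := (Defs.ratio S).
Local Notation V0 := (V0 S).
Local Notation nn := (nn S).
Local Notation ek := (ek S).
Local Notation vert := (vert S).
Local Notation attK := (attK hK).
Local Notation nestK := (nestK hK).
Local Notation rho := (rho hK).
Implicit Types (x y z : E) (w : seq 'I_M) (p q : seq E).

Lemma ek_split s k u v : ek (s + k) u v -> exists w u0 v0,
  [/\ size w = s, ek k u0 v0, u = Psiw S w u0 & v = Psiw S w v0].
Proof.
move=> /asboolP[w [a [b [sw ab -> ->]]]].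
exists (take s w), (Psiw S (drop s w) a), (Psiw S (drop s w) b).
rewrite -!Psiw_cat cat_take_drop; split=> //; first by rewrite size_takel // sw leq_addr.
by apply/asboolP; exists (drop s w), a, b; rewrite size_drop sw addKn.
Qed.

Lemma ek_K k u v : ek k u v -> K u /\ K v.
Proof.
by move=> uv; split; [rewrite (ek_sym hK) in uv|]; apply: (vert_K hK (ek_vert uv)).
Qed.

Lemma vert_cell s w z : size w = s -> K z -> vert s (Psiw S w z) -> V0 z.
Proof.
move=> sw Kz [w' [a [sw' Va]]]; have [->|ww'] := pselect (w = w').
  by move/Psiw_inj => ->.
have sww' : size w = size w' by rewrite sw sw'.
by case/(nesting_words attK nestK sww' ww' Kz (V0_sub attK Va)).
Qed.

(** An edge that leaves the cell starts at a point of two level-[s] cells, and by nesting this is a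
    level-[s] vertex. *)
Lemma cell_path s k w z p : size w = s -> K z -> path (ek (s + k)) (Psiw S w z) p ->
  (forall x, x \in belast (Psiw S w z) p -> ~ vert s x) ->
  exists2 p0, path (ek k) z p0 & p = map (Psiw S w) p0.
Proof.
move=> sw; elim: p z => [|b p IH] z Kz /=; first by exists [::].
move=> /andP[/ek_split[w' [u0 [v0 [sw' uv zE bE]]]] ep] av.
have [Ku Kv] := ek_K uv.
have ww' : w = w'.
  apply: contrapT => ww'; apply: (av _ (mem_head _ _)).
  have sww' : size w = size w' by rewrite sw sw'.
  have [Vz _] := nesting_words attK nestK sww' ww' Kz Ku zE.
  by exists w, z.
move: zE bE; rewrite -ww' => /Psiw_inj zE bE; rewrite bE in ep av *.
have [|p0 ep0 ->] := IH v0 Kv ep; last by exists (v0 :: p0); rewrite //= zE uv.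
by move=> x xp; apply: av; rewrite inE xp orbT.
Qed.

Lemma segment s k z p : (0 < size p)%N -> path (ek (s + k)) z p -> avoids (vert s) z p ->
  exists w z0 p0, [/\ size w = s, path (ek k) z0 p0, K z0, z = Psiw S w z0 & p = map (Psiw S w) p0].
Proof.
case: p => // b p _ /= /andP[/ek_split[w [u0 [v0 [sw uv -> ->]]]] ep] av.
have [Ku Kv] := ek_K uv.
have [p0 ep0 pE] := cell_path sw Kv ep av.
by exists w, u0, (v0 :: p0); rewrite /= uv pE.
Qed.

Lemma path_K k z p : K z -> path (ek k) z p -> K (last z p).
Proof. by apply: path_last => u v /ek_K[]. Qed.

Lemma V0_vert s x : V0 x -> vert s x.
Proof.
move=> Vx; have [[i ix] _] := Vx; exists (nseq s i), x; rewrite size_nseq; split=> //.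
by elim: s => // s IH; rewrite -[nseq s.+1 i]/(i :: nseq s i) Psiw_cons -IH ix.
Qed.

Lemma rho_gt0 k : (0 < rho k)%N.
Proof.
rewrite /rho; case: ex_minnP => -[|m] // /asboolP[x [y [_ _ xy [p [_ lp]]]]] sp _.
by case: xy; rewrite -lp; case: p sp {lp}.
Qed.

(** Up to its next level-[s] vertex the path stays in one cell: it either returns to [b] or joins
    two distinct corners of that cell, which takes [rho k] steps. *)
Lemma first_crossing s k b p : (0 < size p)%N -> path (ek (s + k)) b p -> vert s b ->
  vert s (last b p) -> exists p1 p2,
  [/\ p = p1 ++ p2, (0 < size p1)%N, vert s (last b p1) &
      last b p1 = b \/ (rho k <= size p1)%N /\ exists w x y,
         [/\ size w = s, V0 x, V0 y, b = Psiw S w x & last b p1 = Psiw S w y]].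
Proof.
move=> p0 ep vb vl; have [p1 [p2 [pE sp1 ap1 lp1]]] := first_visit p0 vl.
exists p1, p2; split=> //; move: ep; rewrite pE cat_path => /andP[ep1 _].
have [w [z0 [q [sw eq Kz bE p1E]]]] := segment sp1 ep1 ap1.
have lE : last b p1 = Psiw S w (last z0 q) by rewrite bE p1E last_map.
have Vz : V0 z0 by apply: (vert_cell sw Kz); rewrite -bE.
have Vl : V0 (last z0 q) by apply: (vert_cell sw (path_K Kz eq)); rewrite -lE.
have [zl|zl] := pselect (z0 = last z0 q); first by left; rewrite lE bE -zl.
right; split; last by exists w, z0, (last z0 q).
rewrite p1E size_map; apply: (rho_le hK Vz Vl zl).
by exists q.
Qed.

Lemma rho_separated s k b p : path (ek (s + k)) b p -> vert s b ->
  vert s (last b p) -> b <> last b p -> (rho k <= size p)%N.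
Proof.
have [n] := ubnP (size p); elim: n p b => // n IH p b; rewrite ltnS => pn ep vb vl bl.
have p0 : (0 < size p)%N by case: (p) bl.
have [p1 [p2 [pE sp1 vl1 [lb|[rp _]]]]] := first_crossing p0 ep vb vl; last first.
  by rewrite pE size_cat (leq_trans rp) // leq_addr.
move: pn ep vl bl; rewrite pE size_cat cat_path last_cat lb => pn /andP[_ ep2] vl bl.
rewrite (leq_trans _ (leq_addl _ _)) // (IH p2 b) //.
by apply: leq_trans pn; rewrite -addn1 addnC leq_add2r.
Qed.

Lemma enorm_ge0 x : 0 <= enorm x.
Proof. exact: sqrtr_ge0. Qed.

Lemma V0_diameter : exists2 D : R, 0 < D & forall x y, V0 x -> V0 y -> enorm (x - y) <= D.
Proof.
have [s [_ sV _]] := V0_enum S.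
exists (1 + \sum_(x <- s) \sum_(y <- s) enorm (x - y)).
  by rewrite ltr_wpDr // sumr_ge0 // => x _; rewrite sumr_ge0 // => y _; apply: enorm_ge0.
move=> x y /sV xs /sV ys; rewrite (big_rem _ xs) /= (big_rem _ ys) /= addrCA -addrA lerDl.
rewrite !addr_ge0 ?sumr_ge0 // => z _; first exact: enorm_ge0.
by rewrite sumr_ge0 // => z' _; apply: enorm_ge0.
Qed.

Lemma enorm_Psiw w x y : enorm (Psiw S w x - Psiw S w y) = lam^-1 ^+ size w * enorm (x - y).
Proof.
have /andP[/ltW l0 _] := ratio_inv_bounds S.
rewrite /enorm -!/(normsq _) normsq_Psiw -exprM mulnC exprM sqrtrM ?sqr_ge0 //.
by rewrite sqrtr_sqr ger0_norm // exprn_ge0.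
Qed.

(** Each crossing of a level-[s] cell takes at least [rho k] steps and moves by at most [lam^-s D].
    A single coordinate is followed, so the triangle inequality for absolute values suffices. *)
Lemma crossing_distance (D : R) s k b p j : 0 < D ->
  (forall x y, V0 x -> V0 y -> enorm (x - y) <= D) ->
  path (ek (s + k)) b p -> vert s b -> vert s (last b p) ->
  (rho k)%:R * `|(b - last b p) j ord0| <= (size p)%:R * (lam^-1 ^+ s * D).
Proof.
move=> D0 hD; have /andP[/ltW l0 _] := ratio_inv_bounds S.
have lD0 : 0 <= lam^-1 ^+ s * D by rewrite mulr_ge0 ?exprn_ge0 // ltW.
have [n] := ubnP (size p); elim: n p b => // n IH p b; rewrite ltnS => pn ep vb vl.
have [/size0nil ->|] := posnP (size p); first by rewrite /= subrr mxE normr0 mulr0 mul0r.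
move=> p0; have [p1 [p2 [pE sp1 vl1 h]]] := first_crossing p0 ep vb vl.
move: pn ep vl; rewrite pE size_cat cat_path last_cat => pn /andP[_ ep2] vl.
have {}IH : (rho k)%:R * `|(last b p1 - last (last b p1) p2) j ord0| <=
    (size p2)%:R * (lam^-1 ^+ s * D).
  by apply: IH => //; apply: leq_trans pn; rewrite -addn1 addnC leq_add2r.
rewrite natrD mulrDl.
have -> : (b - last (last b p1) p2) j ord0 =
  (b - last b p1) j ord0 + (last b p1 - last (last b p1) p2) j ord0.
  by rewrite !mxE addrA subrK.
apply: le_trans (ler_wpM2l (ler0n _ _) (ler_normD _ _)) _.
rewrite mulrDr; apply: lerD => //.
case: h => [->|[rp [w [x [y [sw Vx Vy bE lE]]]]]].
  by rewrite subrr mxE normr0 mulr0 mulr_ge0.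
apply: ler_pM; rewrite ?ler0n ?ler_nat //.
apply: le_trans (coord_le_enorm _ _) _.
by rewrite lE {1}bE enorm_Psiw sw ler_wpM2l ?exprn_ge0 // hD.
Qed.

(** Apply [crossing_distance] to a shortest path between two corners of [K], whose Euclidean
    distance is bounded below. *)
Lemma rho_growth : exists2 c0 : R, 0 < c0 & forall s k, c0 * lam ^+ s * (rho k)%:R <= (rho (s + k))%:R.
Proof.
have [D D0 hD] := V0_diameter.
have [a [b [ab _]]] := nn_exists hK; have [_ _ nab _] := ab.
have e0 : 0 < enorm (a - b) by rewrite /enorm sqrtr_gt0 normsqB_gt0.
(* If all coordinates of [x - y] were at most [e], its squared norm would be at most [d e^2], less
   than the minimal [|a - b|^2]. *)
pose e := enorm (a - b) / d.+1%:R; have e00 : 0 < e by rewrite divr_gt0.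
have /andP[l0 _] := ratio_inv_bounds S; have li0 : 0 < lam by rewrite -invr_gt0.
exists (e / D); first by rewrite divr_gt0.
move=> s k; have [x [y [Vx Vy xy]]] : exists x y, [/\ V0 x, V0 y, x <> y &
    reach (ek (s + k)) x y (rho (s + k))].
  by rewrite /rho; case: ex_minnP => m /asboolP.
move=> [p [ep lp sp]].
have [j ej] : exists j, e <= `|(x - y) j ord0|.
  apply: contrapT => ne; have : normsq (x - y) <= d%:R * e ^+ 2.
    apply: normsq_le => j; rewrite leNgt; apply/negP => /ltW h; apply: ne; by exists j.
  apply/negP; rewrite -ltNge; apply: lt_le_trans (nn_min hK ab Vx Vy xy).
  rewrite -enorm_sqr /e expr_div_n mulrA ltr_pdivrMr ?exprn_gt0 // mulrC ltr_pM2l ?exprn_gt0 //.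
  by rewrite -natrX ltr_nat; nia.
have h : (rho k)%:R * e <= (rho (s + k))%:R * (lam^-1 ^+ s * D).
  apply: (@le_trans _ _ ((rho k)%:R * `|(x - y) j ord0|)); first by rewrite ler_wpM2l.
  rewrite -lp; apply: le_trans (crossing_distance j D0 hD ep _ _) _; rewrite ?lp;
    try exact: V0_vert.
  by rewrite ler_wpM2r ?ler_nat // mulr_ge0 ?exprn_ge0 // ltW.
rewrite -(ler_pM2r (_ : 0 < lam^-1 ^+ s * D)); last by rewrite mulr_gt0 ?exprn_gt0.
apply: le_trans h; rewrite exprVn.
have -> : e / D * lam ^+ s * (rho k)%:R * ((lam ^+ s)^-1 * D) =
   (rho k)%:R * e * (lam ^+ s / lam ^+ s) * (D / D) by ring.
by rewrite !divff ?mulr1 ?gt_eqF ?exprn_gt0.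
Qed.

Lemma rho_monotone k : (rho k <= rho k.+1)%N.
Proof.
have [x [y [Vx Vy xy]]] : exists x y, [/\ V0 x, V0 y, x <> y &
    reach (ek (1 + k)) x y (rho k.+1)].
  by rewrite /rho; case: ex_minnP => m /asboolP.
move=> [p [ep lp sp]]; apply: leq_trans sp.
by apply: (rho_separated ep); rewrite ?lp; [exact: V0_vert|exact: V0_vert|].
Qed.

(** Walk along corners of level-1 cells to the cell that contains [v], then recurse inside it; the
    costs at successive levels add up. *)
Lemma vert_reach : exists A, forall k x v, V0 x -> vert k v ->
  reach (ek k) x v (A * \sum_(j < k.+1) rho j).
Proof.
have [b0 hb0] := corners_reach_rho hK hS.
exists (M ^ 1 * M * b0 + b0)%N; elim=> [|k IH] x v Vx vv.
  have Vv : V0 v by case: vv => w [y [/size0nil -> Vy ->]].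
  apply: reach_leq (hb0 0%N x v Vx Vv).
  by rewrite big_ord_recl big_ord0 addn0 leq_mul2r leq_addl orbT.
have [w [y [sw Vy vE]]] := vv; case: w sw vE => // i w [sw] vE.
have h1 : reach (ek k.+1) (Psi S i x) v ((M ^ 1 * M * b0 + b0) * \sum_(j < k.+1) rho j).
  rewrite vE Psiw_cons; apply: (reach_map (e := ek k)) => [a b|]; first exact: (@ek_Psiw _ _ _ S [:: i]).
  by apply: IH => //; exists w, y.
have h2 : reach (ek k.+1) x (Psi S i x) (M ^ 1 * M * (b0 * rho k)).
  apply: reach_refine (cellmates_reach_ek (hb0 k)) _.
  by apply: (cellmates_reach hK); [apply: V0_vert|exists [:: i], x].
apply: reach_leq (reach_trans h2 h1).
rewrite [X in (_ <= _ * X)%N]big_ord_recr /= mulnDr addnC leq_add2l.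
rewrite mulnA leq_mul ?leq_addr //; exact: rho_monotone.
Qed.

(** By [rho_growth] the terms decrease geometrically from [j = k] downwards, so a constant times the
    last one bounds the sum. *)
Lemma sum_rho : exists C, forall k, (\sum_(j < k.+1) rho j <= C * rho k)%N.
Proof.
have [c0 c00 hc] := rho_growth; have /andP[l0 l1] := ratio_inv_bounds S.
have li0 : 0 < lam by rewrite -invr_gt0.
pose C := Num.Def.archi_bound (c0^-1 / (1 - lam^-1)).
have C0 : c0^-1 / (1 - lam^-1) <= C%:R.
  by apply/ltW/archi_boundP; rewrite divr_ge0 ?invr_ge0 ?ltW // subr_gt0.
exists C => k; rewrite -(ler_nat R) natrM natr_sum.
have geo n : \sum_(j < n) lam^-1 ^+ j <= (1 - lam^-1)^-1.
  rewrite -[leRHS]mul1r ler_pdivlMr ?subr_gt0 // mulrC -opprB mulNr -subrX1 opprB.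
  by rewrite lerBlDr lerDl exprn_ge0 // ltW.
have h (j : 'I_k.+1) : (rho j)%:R <= c0^-1 * (rho k)%:R * lam^-1 ^+ (k - j).
  have := hc (k - j)%N j; rewrite subnK ?(ltnSE (ltn_ord j)) // => hj.
  rewrite exprVn ler_pdivlMr ?exprn_gt0 // mulrC ler_pdivlMl //.
  by rewrite mulrA.
apply: le_trans (ler_sum _ (fun j _ => h j)) _.
rewrite -mulr_sumr (reindex_inj rev_ord_inj) /=.
have -> : \sum_(j < k.+1) lam^-1 ^+ (k - (k.+1 - j.+1)) = \sum_(j < k.+1) lam^-1 ^+ j.
  by apply: eq_bigr => j _; rewrite subSS subKn // -ltnS.
rewrite mulrAC ler_wpM2r ?ler0n //; apply: le_trans C0.
by rewrite ler_wpM2l ?geo ?invr_ge0 ?ltW.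
Qed.

(** Choose [k] with [B rho_k <= n < B rho_(k+1)], where [B = A C + 1]. The first inequality gives
    [A Q_k <= n]. Going up [s'] further levels multiplies [rho] by at least [B], so
    [n <= rho_(k+1+s')]. *)
Lemma scales_exist C Q : (forall k, (Q k <= C * rho k)%N) ->
  forall A, exists s n0, forall n, (n0 <= n)%N ->
  exists2 k, (n <= rho (k + s))%N & (A * Q k <= n)%N.
Proof.
move=> QC A; have [c0 c00 hc] := rho_growth; pose B := (A * C).+1.
have [s' hs'] := expr_unbounded (B%:R / c0) (ratio_gt1 S).
have {}hs' : B%:R <= c0 * lam ^+ s' by rewrite -ler_pdivrMl // mulrC hs'.
exists s'.+1, (B * rho 0)%N => n hn.
have ex : exists k, (n < B * rho k)%N.
  have [m hm] := expr_unbounded (n.+1%:R / c0) (ratio_gt1 S).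
  exists (m + 0)%N; apply: (@leq_trans (rho (m + 0))); last by rewrite leq_pmull.
  rewrite -(ler_nat R); apply: le_trans (hc m 0%N).
  have := hm m (leqnn m); rewrite ler_pdivrMr // mulrC => /le_trans; apply.
  by rewrite ler_peMr ?mulr_ge0 ?exprn_ge0 ?ler1n ?rho_gt0 // ltW // (lt_trans ltr01 (ratio_gt1 S)).
case: (ex_minnP ex) => -[|k] hk kmin; first by move: hk; rewrite ltnNge hn.
have kn : (B * rho k <= n)%N by rewrite leqNgt; apply/negP => /kmin; rewrite ltnn.
exists k; last first.
  apply: leq_trans kn; apply: leq_trans (_ : A * (C * rho k) <= _)%N; first by rewrite leq_mul2l QC orbT.
  by rewrite mulnA leq_mul2r leqnSn orbT.
rewrite addnS -addSn addnC; apply: leq_trans (ltnW hk) _.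
rewrite -(ler_nat R) natrM; apply: le_trans (hc s' k.+1).
by rewrite ler_wpM2r // ler0n.
Qed.
End Growth.

(* Pigeonhole on a fine grid. *)
Lemma le_card_separated (R : realType) (d : nat) (B eps : R) : 0 < eps ->
  exists N, forall (X : eqType) (P : X -> Prop) (f : X -> 'cV[R]_d),
  (forall a, P a -> forall j, `|f a j ord0| <= B) ->
  (forall a b, P a -> P b -> a <> b -> eps ^+ 2 <= normsq (f a - f b)) ->
  le_card P N.
Proof.
move=> eps0; pose h := eps / d.+1%:R; have h0 : 0 < h by rewrite divr_gt0.
pose G := Num.truncn (2 * B / h).
exists #|{ffun 'I_d -> 'I_G.+1}| => X P f fB fsep.
pose cellof a : {ffun 'I_d -> 'I_G.+1} := [ffun j => inord (Num.truncn ((f a j ord0 + B) / h))].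
have fin : le_card (fun _ : {ffun 'I_d -> 'I_G.+1} => True) #|{ffun 'I_d -> 'I_G.+1}|.
  move=> s us _; rewrite cardE; apply: uniq_leq_size => // t _; exact: mem_enum.
apply: (le_card_inj (f := cellof) _ _ fin) => // a b Pa Pb ab.
apply: contrapT => nab; have := fsep a b Pa Pb nab; apply/negP; rewrite -ltNge.
have hd : normsq (f a - f b) <= d%:R * h ^+ 2.
  apply: normsq_le => j; rewrite !mxE.
  have ge0 c : P c -> 0 <= (f c j ord0 + B) / h.
    by move=> Pc; apply: divr_ge0 (ltW h0); have := fB c Pc j; rewrite ler_norml; lra.
  have ltG c : P c -> (Num.truncn ((f c j ord0 + B) / h) < G.+1)%N.
    move=> Pc; rewrite ltnS; apply: le_truncn; rewrite ler_wpM2r ?invr_ge0 ?(ltW h0) //.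
    by have := fB c Pc j; rewrite ler_norml; lra.
  have /(congr1 (fun t : {ffun 'I_d -> 'I_G.+1} => val (t j))) := ab.
  rewrite !ffunE /= !inordK ?ltG // => tab.
  have /andP[] := truncn_itv (ge0 a Pa); have /andP[] := truncn_itv (ge0 b Pb).
  rewrite tab -natr1 ler_pdivlMr // ltr_pdivrMr // ler_pdivlMr // ltr_pdivrMr // ler_norml.
  by lra.
apply: le_lt_trans hd _; rewrite /h expr_div_n mulrA ltr_pdivrMr ?exprn_gt0 // mulrC.
by rewrite ltr_pM2l ?exprn_gt0 // -natrX ltr_nat; nia.
Qed.

(** * Bounded number of cells at a point *)

Section Packing.
Variables (R : realType) (d M : nat) (S : similitudes R d M) (K : set 'cV[R]_d).
Hypothesis hK : nested_fractal S K.
Local Notation E := 'cV[R]_d.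
Local Notation lam := (Defs.ratio S).
Local Notation attK := (attK hK).
Implicit Types (x y z : E) (w : seq 'I_M).

Lemma Psiw_surj w y : exists x, Psiw S w x = y.
Proof.
elim: w y => [|i w IH] y; first by exists y.
by have [x xE] := IH (Psi_inv S i y); exists x; rewrite Psiw_cons xE Psi_invK.
Qed.

Lemma compact_coordinates (A : set E) : compact A ->
  exists B : R, forall x, A x -> forall j, `|x j ord0| <= B.
Proof.
move=> cA; have /choice[b bP] : forall j : 'I_d, exists b : R, forall x, A x -> `|x j ord0| <= b.
  move=> j; have : compact ((fun x : E => x j ord0) @` A).
    by apply: continuous_compact cA; apply: continuous_subspaceT; apply: coord_continuous.
  move=> /compact_bounded[N [_ NP]]; exists (N + 1) => x Ax.
  by apply: (NP (N + 1)); [rewrite ltrDl|exists x].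
exists (\sum_j `|b j|) => x Ax j; apply: le_trans (bP j x Ax) _.
by rewrite (bigD1 j) //= ler_wpDr ?sumr_ge0 // ler_norm.
Qed.

(** A ball around [c] inside the open set [U] has disjoint images in distinct cells. Rescaled by
    [lam^m] about [x], the images of [c] stay in a bounded region and are [eps]-separated. *)
Lemma packing : exists N, forall m x,
  le_card (fun w => size w = m /\ exists2 y, K y & x = Psiw S w y) N.
Proof.
have [_ _ [U [[c Uc] _ oU dU sU]] _ _] := hK.
have [eps /= eps0 epsU] : exists2 eps : R, 0 < eps & ball c eps `<=` U.
  by have /nbhs_ballP[eps ? ?] := open_nbhs_nbhs (conj oU Uc); exists eps.
have UPsi w y : U y -> U (Psiw S w y).
  move=> Uy; elim: w => // i w IH; apply: sU; exists i => //; by exists (Psiw S w y).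
have disj w v y z : size w = size v -> w <> v -> U y -> U z -> Psiw S w y <> Psiw S v z.
  elim: w v => [|i w IH] [|j v] // [swv] wv Uy Uz; rewrite !Psiw_cons => yz.
  have [ij|nij] := pselect (i = j).
    subst j; move/Psi_inj: yz; apply: IH => // wv'; by apply: wv; rewrite wv'.
  have : (Psi S i @` U `&` Psi S j @` U) (Psi S i (Psiw S w y)).
    by split; [exists (Psiw S w y) => //; exact: UPsi|exists (Psiw S v z) => //; exact: UPsi].
  by rewrite dU.
have [B0 hB0] := compact_coordinates (let: And3 _ cK _ := attK in cK).
have /andP[l0 l1] := ratio_inv_bounds S; have li0 : 0 < lam by rewrite -invr_gt0.
have [[y0 Ky0] _ _] := attK.
have [D hD] : exists D : R, forall y, K y -> enorm (c - y) <= D.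
  pose b := enorm c + `|B0|; exists (d.+1%:R * b) => y Ky.
  have b0 : 0 <= b by rewrite addr_ge0 ?enorm_ge0.
  have h : normsq (c - y) <= d%:R * b ^+ 2.
    apply: normsq_le => j; rewrite !mxE; apply: le_trans (ler_normB _ _) _.
    by rewrite lerD ?coord_le_enorm // (le_trans (hB0 y Ky j)) // ler_norm.
  rewrite -(ler_pXn2r (_ : (0 < 2)%N)) ?nnegrE ?enorm_ge0 ?mulr_ge0 // enorm_sqr.
  apply: le_trans h _; rewrite exprMn ler_wpM2r ?exprn_ge0 // -natrX ler_nat; nia.
have [N NP] := @le_card_separated R d D eps eps0; exists N => m x.
apply: (NP _ _ (fun w => lam ^+ m *: (Psiw S w c - x))) => [w [sw [y Ky xE]] j|].
  rewrite mxE normrM ger0_norm ?exprn_ge0 ?(ltW li0) //.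
  apply: (@le_trans _ _ (lam ^+ m * enorm (Psiw S w c - x))).
    by rewrite ler_wpM2l ?exprn_ge0 ?(ltW li0) // coord_le_enorm.
  rewrite xE enorm_Psiw sw mulrA -exprMn divff ?gt_eqF // expr1n mul1r.
  exact: hD.
move=> w v [sw _] [sv _] wv; rewrite leNgt; apply/negP => close.
have [c' c'E] := Psiw_surj w (Psiw S v c).
apply: (disj w v c' c); rewrite ?sw ?sv //.
apply: epsU; split=> // j k; rewrite ord1 /ball /=.
have -> : c j ord0 - c' j ord0 = (c - c') j ord0 by rewrite !mxE.
apply: le_lt_trans (coord_le_enorm _ _) _.
rewrite -(ltr_pXn2r (_ : (0 < 2)%N)) ?nnegrE ?enorm_ge0 ?(ltW eps0) // enorm_sqr.
apply: le_lt_trans close.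
have -> : lam ^+ m *: (Psiw S w c - x) - lam ^+ m *: (Psiw S v c - x) =
    lam ^+ m *: (Psiw S w c - Psiw S v c) by rewrite -scalerBr opprB addrA subrK.
rewrite -[_ *: _]addr0 normsqZD normsq0 /dotv big1 => [|i _]; last by rewrite mxE mul0r.
have e1 : lam ^+ m ^+ 2 * lam^-1 ^+ 2 ^+ m = 1.
  by rewrite -!exprM (mulnC m) exprVn divff // gt_eqF // exprn_gt0.
by rewrite -c'E normsq_Psiw sw mulr0 !add0r mulrA e1 mul1r.
Qed.
End Packing.

(** * Cells of the infinite graph *)

Section FractalGraph.
Variables (R : realType) (d M : nat) (S : similitudes R d M) (K : set 'cV[R]_d).
Hypothesis hK : nested_fractal S K.
Hypothesis hS : one_point_intersection S.
Variables (O : 'cV[R]_d) (i0 : 'I_M).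
Hypothesis hO : V0 S O.
Hypothesis hfix : Psi S i0 O = O.
Local Notation E := 'cV[R]_d.
Local Notation V0 := (V0 S).
Local Notation ek := (ek S).
Local Notation vert := (vert S).
Local Notation attK := (attK hK).
Local Notation nestK := (nestK hK).
Local Notation rho := (rho hK).
Local Notation G := (Finfty S i0).
Implicit Types (x y z : E) (w : seq 'I_M) (p q : seq E).

(** A contraction: it pulls the part [F_m] of the infinite graph back into [K], where [ek m] and
    [vert m] live. Its inverse [down m] is the blow-up. *)
Definition up m : E -> E := iter m (Psi S i0).
Definition down m : E -> E := iter m (Psi_inv S i0).
Definition einf : rel E := fun x y => `[< adj G x y >].

Lemma downK m : cancel (down m) (up m).
Proof. by elim: m => // m IH x; rewrite /down iterS /up iterSr Psi_invK; apply: IH. Qed.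

Lemma upK m : cancel (up m) (down m).
Proof. by elim: m => // m IH x; rewrite /up iterS /down iterSr PsiK; apply: IH. Qed.

Lemma upE m x : up m x = Psiw S (nseq m i0) x.
Proof. by elim: m => // m IH; rewrite /up iterS -/(up m x) IH. Qed.

Lemma up_add m n x : up (m + n) x = Psiw S (nseq m i0) (up n x).
Proof. by rewrite /up iterD -!/(up _ _) upE. Qed.

Lemma up_O m : up m O = O.
Proof. by elim: m => // m; rewrite /up iterS => ->. Qed.

Lemma down_O m : down m O = O.
Proof. by rewrite -{1}(up_O m) upK. Qed.

Lemma einfP x y : einf x y <-> exists m, ek m (up m x) (up m y).
Proof.
split.
  move=> /asboolP[m [w [a [b [ab /= <- <-]]]]]; exists m; rewrite -!/(down _ _) !downK.
  by apply/asboolP; exists w, a, b; rewrite size_tuple.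
move=> [m /asboolP[w [a [b [sw ab ua vb]]]]]; apply/asboolP; exists m.
have sw' : size w == m by apply/eqP.
exists (Tuple sw'), a, b; rewrite /= -ua -vb -!/(down _ _) !upK; split=> //.
Qed.

Lemma vertices_Finfty z : vertices G z <-> exists m, vert m (up m z).
Proof.
split.
  move=> [m _ [w _ [a Va /= <-]]]; exists m; rewrite -/(down _ _) downK.
  by exists w, a; rewrite size_tuple.
move=> [m [w [a [sw Va za]]]]; exists m => //.
have sw' : size w == m by apply/eqP.
by exists (Tuple sw') => //; exists a => //=; rewrite -za -/(down _ _) upK.
Qed.

Lemma einf_sym : symmetric einf.
Proof. by move=> x y; apply/idP/idP => /einfP[m h]; apply/einfP; exists m; rewrite (ek_sym hK). Qed.

Lemma einf_vertices x y : einf x y -> vertices G y.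
Proof. by move=> /einfP[m /ek_vert h]; apply/vertices_Finfty; exists m. Qed.

Lemma vertices_O : vertices G O.
Proof. by apply/vertices_Finfty; exists 0%N; exists [::], O. Qed.

Lemma ek_up m n x y : ek m (up m x) (up m y) -> ek (n + m) (up (n + m) x) (up (n + m) y).
Proof. by move=> h; rewrite !up_add -{1}(size_nseq n i0); apply: ek_Psiw. Qed.

(** Edges persist from one level to the next, so the finitely many edges of a path are all present
    at every large level. *)
Lemma path_up z p : path einf z p ->
  exists m0, forall m, (m0 <= m)%N -> path (ek m) (up m z) (map (up m) p).
Proof.
elim: p z => [|b p IH] z /=; first by exists 0%N.
move=> /andP[/einfP[m1 zb] /IH[m2 h]]; exists (maxn m1 m2) => m; rewrite geq_max.
by move=> /andP[m1m /h ->]; rewrite andbT -(subnK m1m); apply: ek_up.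
Qed.

(* The vertices of the copies of V0 at scale lam^k. *)
Definition kvert k z : Prop := exists m, vert m (up (m + k) z).

Lemma vert_up n m k z : vert m (up (m + k) z) -> vert (n + m) (up (n + m + k) z).
Proof.
move=> [w [a [sw Va za]]]; exists (nseq n i0 ++ w), a.
by rewrite size_cat size_nseq sw Psiw_cat -za -addnA up_add.
Qed.

Lemma vert_up_leq m0 m k z : (m0 <= m)%N -> vert m0 (up (m0 + k) z) -> vert m (up (m + k) z).
Proof. by move=> m0m; rewrite -(subnK m0m); apply: vert_up. Qed.

(* psi is the inverse of the embedding of E_k, the union of the level-k images of F_0,
   as a cell of the infinite graph that contains z. *)
Definition chart k z (psi : E -> E) : Prop := K (psi z) /\
  exists w, forall x, up (size w + k) x = Psiw S w (psi x).

Lemma chart_up k z psi : chart k z psi -> exists m0, forall m, (m0 <= m)%N ->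
  exists2 w, size w = m & forall x, up (m + k) x = Psiw S w (psi x).
Proof.
move=> [_ [w wP]]; exists (size w) => m wm; exists (nseq (m - size w) i0 ++ w).
  by rewrite size_cat size_nseq subnK.
by move=> x; rewrite Psiw_cat -wP -up_add addnA subnK.
Qed.

Lemma chart_inj k z psi : chart k z psi -> injective psi.
Proof.
move=> [_ [w wP]] x y xy; apply: (can_inj (upK (size w + k))).
by rewrite !wP xy.
Qed.

(** Pulled back by [up], the path avoids the corners of level [m0], so it stays in a cell given by a
    word [w] of that length; then [psi] is [up] followed by the inverse of [Psiw S w]. *)
Lemma chart_segment k z p : (0 < size p)%N -> path einf z p -> avoids (kvert k) z p ->
  exists2 psi, chart k z psi & path (ek k) (psi z) (map psi p).
Proof.
move=> p0 /path_up[m0 hm0] av.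
have pm := hm0 (m0 + k)%N (leq_addr _ _).
have [||w [z0 [p1 [sw ep1 Kz0 zE pE]]]] := segment hK _ pm; first by rewrite size_map.
  move=> x; rewrite belast_map behead_map => /mapP[y yp ->] vy.
  by apply: av yp _; exists m0.
have /choice[psi psiP] : forall x, exists y, Psiw S w y = up (m0 + k) x.
  by move=> x; apply: Psiw_surj.
have psiz : psi z = z0 by apply: (@Psiw_inj _ _ _ S w); rewrite psiP.
have psip : map psi p = p1.
  apply: (inj_map (@Psiw_inj _ _ _ S w)); rewrite -pE -map_comp.
  by apply: eq_map => x /=; rewrite psiP.
exists psi; last by rewrite psiz psip.
by split; [rewrite psiz|exists w => x; rewrite sw psiP].
Qed.

(** At a level common to finitely many charts, each is determined by a word whose cell contains the
    image of [z]; [packing] bounds the number of these words. *)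
Lemma le_card_charts : exists N, forall k z, le_card (chart k z) N.
Proof.
have [N NP] := packing hK; exists N => k z s us sP.
have [m mP] : exists m, forall psi, psi \in s ->
    exists2 w, size w = m & forall x, up (m + k) x = Psiw S w (psi x).
  suff [m0 m0P] : exists m0, forall m, (m0 <= m)%N -> forall psi, psi \in s ->
    exists2 w, size w = m & forall x, up (m + k) x = Psiw S w (psi x).
    by exists m0; apply: m0P.
  elim: s {us} sP => [|psi s IH] sP; first by exists 0%N.
  have [m1 m1P] : exists m0, forall m, (m0 <= m)%N ->
      exists2 w, size w = m & forall x, up (m + k) x = Psiw S w (psi x).
    by apply: (chart_up (sP psi (mem_head _ _))).
  have [|m2 m2P] := IH; first by move=> f fs; apply: sP; rewrite inE fs orbT.
  exists (maxn m1 m2) => m; rewrite geq_max => /andP[/m1P h1 /m2P h2] f.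
  by rewrite inE => /orP[/eqP ->//|/h2].
have /choice[f fP] : forall psi : E -> E, exists w, psi \in s ->
    size w = m /\ forall x, up (m + k) x = Psiw S w (psi x).
  move=> psi; have [/mP[w ? ?]|_] := boolP (psi \in s); first by exists w.
  by exists [::].
apply: (@le_card_inj _ _ f (fun psi => psi \in s) _ _ _ _ (NP m (up (m + k) z))) => //.
  move=> psi psi' /fP[_ h] /fP[_ h'] ff'; apply/funext => x.
  by apply: (@Psiw_inj _ _ _ S (f psi)); rewrite -h {1}ff' -h'.
move=> psi ps; have [fs h] := fP _ ps; split=> //.
by exists (psi z) => //; case: (sP _ ps).
Qed.

(** The reflection carries the corner [y] to [O] and needs [y <> O]. At a point that is not a
    corner, the identity is taken, since such a point need not be moved to [O]. *)
Definition recenter y : E -> E :=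
  if `[< V0 y /\ y <> O >] then reflection y O else id.

Lemma recenter_corner y : V0 y -> recenter y y = O.
Proof.
move=> Vy; rewrite /recenter; case: asboolP => [[_ yO]|]; first exact: reflectionl.
by move=> h; apply: contrapT => yO; apply: h.
Qed.

Lemma recenter_inj y : injective (recenter y).
Proof.
rewrite /recenter; case: asboolP => [[_ yO]|_]; last by [].
exact: can_inj (reflectionK yO).
Qed.

Lemma recenter_ek k y u v : ek k u v -> ek k (recenter y u) (recenter y v).
Proof.
rewrite /recenter; case: asboolP => [[Vy yO]|_] //.
exact: (ek_reflection hK).
Qed.

Lemma down_ek k u v : ek k u v -> einf (down k u) (down k v).
Proof. by move=> uv; apply/einfP; exists k; rewrite !downK. Qed.

Lemma kvert_chart k z psi : chart k z psi -> kvert k z -> V0 (psi z).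
Proof.
move=> cz [m vm]; have Kz := cz.1; have [m0 m0P] := chart_up cz.
have [w sw wP] := m0P (m0 + m)%N (leq_addr _ _).
by apply: (vert_cell hK sw Kz); rewrite -wP; apply: vert_up.
Qed.

(** Each map is a chart into [K], followed by the reflection that takes the corner to [O] and by the
    blow-up [down k]. The radius comes from [vert_reach]. *)
Lemma charts_exist : exists N A, cell_charts einf (vertices G) O N kvert
  (fun k => A * \sum_(j < k.+1) rho j)%N.
Proof.
have [N NP] := le_card_charts; have [A AP] := vert_reach hK hS; exists N, A => k z _.
have [fs [_ fsP sfs]] := le_card_enum (NP k z).
exists (fun i => down k \o recenter (nth id fs i z) \o nth id fs i) => p p0 ep av.
have [psi cz epsi] := chart_segment p0 ep av.
have psfs : psi \in fs by apply/fsP.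
exists (index psi fs); cbv beta; rewrite !nth_index //; split.
- by rewrite (leq_trans _ sfs) // index_mem.
- move=> x y /= /(can_inj (downK k)) /recenter_inj; exact: (chart_inj cz).
- rewrite (map_comp (down k \o recenter (psi z)) psi).
  rewrite -[X in path _ X]/((down k \o recenter (psi z)) (psi z)) path_map.
  by apply: sub_path epsi => u v uv; apply: down_ek; apply: recenter_ek.
- move=> x xp; have vx : vert k (recenter (psi z) (psi x)).
    have : psi x \in psi z :: map psi p by rewrite -map_cons map_f.
    have {}epsi : path (ek k) (recenter (psi z) (psi z)) (map (recenter (psi z)) (map psi p)).
      by rewrite path_map; apply: sub_path epsi => u v; apply: recenter_ek.
    move=> /(map_f (recenter (psi z))) /=.
    move: (recenter _ (psi x)) => t.
    case: p p0 epsi {ep av xp} => // b p _ /= /andP[zb ebp].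
    rewrite inE => /orP[/eqP ->|]; first by apply: ek_vert; rewrite (ek_sym hK) in zb; exact: zb.
    rewrite inE => /orP[/eqP ->|tp]; first exact: ek_vert zb.
    move: ebp tp; clear; move: (recenter _ (psi b)) (map _ (map psi p)) => u l.
    elim: l u => //= v l IH u /andP[/ek_vert uv el].
    by rewrite inE => /orP[/eqP ->//|]; apply: IH el.
  by rewrite /= -(down_O k); apply: (reach_map (@down_ek k)); apply: AP.
- by move=> kz /=; rewrite recenter_corner ?down_O //; apply: kvert_chart cz kz.
Qed.

(** A single edge has no interior vertex, so each neighbour lies in a level-0 cell at the given
    vertex; boundedly many charts occur, and each cell has at most [M] corners. *)
Lemma degree_bound : exists D, forall x, vertices G x -> le_card (fun y => einf x y) D.
Proof.
have [N NP] := le_card_charts; exists (\sum_(i < N) M ^ 0 * M)%N => z _.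
have [fs [_ fsP sfs]] := le_card_enum (NP 0%N z).
pose Pi i y := chart 0 z (nth id fs i) /\ vert 0 (nth id fs i y).
apply: (@le_card_bigcup _ Pi _ _ (fun=> M ^ 0 * M)%N) => [y zy|i _].
  have ep : path einf z [:: y] by rewrite /= zy.
  have av : avoids (kvert 0) z [:: y] by [].
  have [psi cz /=] := chart_segment (p := [:: y]) isT ep av; rewrite andbT => /ek_vert vy; have psfs : psi \in fs by apply/fsP.
  exists (index psi fs); first by rewrite (leq_trans _ sfs) // index_mem.
  by rewrite /Pi nth_index.
have [cz|ncz] := pselect (chart 0 z (nth id fs i)); last first.
  by move=> [|y s] // _ /(_ y (mem_head _ _))[].
apply: (le_card_inj (f := nth id fs i) _ _ (@le_card_vert _ _ _ S 0)); last by move=> y [].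
by move=> x y _ _; apply: (chart_inj cz).
Qed.

Lemma kvert_separated k n : (n <= rho k)%N -> separated einf kvert k n.
Proof.
move=> nk x y p [mx vx] [my vy] xy ep lp; apply: leq_trans nk _.
have [m0 hm0] := path_up ep; pose m := (m0 + mx + my)%N.
have mm : (m0 <= m + k)%N by rewrite /m; lia.
rewrite -(size_map (up (m + k))); apply: (rho_separated hK (hm0 _ mm)).
- by apply: vert_up_leq vx; rewrite /m; lia.
- by rewrite last_map lp; apply: vert_up_leq vy; rewrite /m; lia.
- by rewrite last_map lp => /(can_inj (upK _)).
Qed.

(** A chart of the level-[(k + s)] cell takes its [k]-vertices to [vert s], which is finite. A
    [k]-vertex belonging to another cell as well would be a corner of level [k + s], which the path
    avoids. *)
Lemma kvert_visits s : exists Q, forall k a p, vertices G a -> path einf a p -> uniq (a :: p) ->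
  avoids (kvert (k + s)) a p ->
  le_card (fun x => x \in behead (belast a p) /\ kvert k x) Q.
Proof.
exists (M ^ s * M)%N => k a p _ ep _ av.
case: (posnP (size p)) => [/size0nil ->|p0].
  by move=> [|x t] // _ /(_ x (mem_head _ _))[].
have [psi cz epsi] := chart_segment p0 ep av.
have [m0 m0P] := chart_up cz.
apply: (le_card_inj (f := psi) _ _ (@le_card_vert _ _ _ S s)).
  by move=> x y _ _; apply: (chart_inj cz).
move=> x [xp [m1 vx]]; have [w sw wP] := m0P (m0 + m1)%N (leq_addr _ _).
have Kx : K (psi x).
  have : psi x \in psi a :: map psi p.
    by rewrite -map_cons map_f // lastI mem_rcons inE (mem_behead xp) orbT.
  move: cz.1 epsi; clear -hK; move: (psi a) (psi x) (map psi p) => b y l.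
  elim: l b => [|c l IH] b Kb /=; first by rewrite inE => _ /eqP ->.
  move=> /andP[/(ek_K hK)[_ Kc] el]; rewrite inE => /orP[/eqP ->//|]; exact: IH el.
have [w' [q [sw' Vq qE]]] : vert (m0 + m1 + s) (up (m0 + m1 + s + k) x).
  by apply: vert_up_leq vx; lia.
have E1 : Psiw S w (psi x) = Psiw S (take (m0 + m1) w') (Psiw S (drop (m0 + m1) w') q).
  by rewrite -Psiw_cat cat_take_drop -qE -wP; congr (up _ x); lia.
have st : size (take (m0 + m1) w') = (m0 + m1)%N by rewrite size_takel // sw' leq_addr.
have [ww'|ww'] := pselect (w = take (m0 + m1) w').
  move: E1; rewrite -ww' => /Psiw_inj ->; exists (drop (m0 + m1) w'), q.
  by rewrite size_drop sw' addKn.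
have swt : size w = size (take (m0 + m1) w') by rewrite sw st.
have Kq : K (Psiw S (drop (m0 + m1) w') q) by apply: (attractor_Psiw attK); apply: (V0_sub attK).
have [Vx _] := nesting_words attK nestK swt ww' Kx Kq E1.
by case: (av x xp); exists (m0 + m1)%N; exists w, (psi x); rewrite wP.
Qed.

(** Two corners of a large cell at [O] are joined by a path; without loops it still has at least [n]
    steps, by separation, and is then truncated. *)
Lemma saw_exists n : exists p, saw einf O n p.
Proof.
(* With zero radius and zero factor, this only provides a level at which [rho] is large. *)
have [s [n0 sP]] := @scales_exist _ _ _ _ _ hK 0 (fun=> 0%N) (fun=> leq0n _) 0.
have [k nk _] := sP (maxn n n0) (leq_maxr _ _).
have [x [Vx xO]] : exists x, V0 x /\ x <> O.
  have [x [y [Vx Vy xy]]] := V0_two hK; have [xO|xO] := pselect (x = O); last by exists x.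
  by exists y; split=> // yO; apply: xy; rewrite xO yO.
have [h hP] := corners_reach hK (k + s).
have [p [ep lp _]] : reach einf O (down (k + s) x) h.
  by rewrite -(down_O (k + s)); apply: (reach_map (@down_ek (k + s))); apply: hP.
have nsep := kvert_separated (leqnn (rho (k + s))).
case/shortenP: ep lp => p' ep' up' _ lp'.
have np' : (n <= size p')%N.
  apply: leq_trans (leq_maxl n n0) _; apply: leq_trans nk _.
  apply: (nsep O (down (k + s) x)) => //.
  - by exists 0%N; exists [::], O; rewrite add0n up_O.
  - by exists 0%N; exists [::], x; rewrite add0n downK.
  - by move=> /(congr1 (up (k + s))); rewrite downK up_O => /esym.
by exists (take n p'); apply: (@saw_take _ einf O (size p')).
Qed.
End FractalGraph.

(** * From cardinality bounds to extended real counts *)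

Lemma least_nat (Q : nat -> Prop) : (exists m, Q m) -> exists m, Q m /\ forall m', Q m' -> (m <= m')%N.
Proof.
move=> [m Qm]; have ex : exists m, `[< Q m >] by exists m; apply/asboolP.
case: (ex_minnP ex) => l /asboolP Ql lmin; exists l; split=> // m' Qm'.
by apply: lmin; apply/asboolP.
Qed.

Section Counting.
Variable R : realType.

Lemma counting_least (X : choiceType) (P : X -> Prop) m : le_card P m ->
  (forall m', le_card P m' -> (m <= m')%N) -> counting [set x | P x] = m%:R%:E :> \bar R.
Proof.
move=> Pm mmin; have [s [us sP sm]] := le_card_enum Pm.
have -> : m = size s.
  apply/eqP; rewrite eqn_leq sm andbT; apply: mmin => t ut tP.
  by apply: uniq_leq_size => // x /tP /sP.
have E : [set x | P x] = [set` s] by apply/seteqP; split=> x /=; [move=> h; apply/sP|move=> /sP].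
rewrite /counting asboolT; last by rewrite E.
congr (_%:R%:E); rewrite E.
apply: perm_size; apply: uniq_perm => // x.
by rewrite in_fset_set // mem_setE.
Qed.

Lemma counting_le (X : choiceType) (P : X -> Prop) m : le_card P m ->
  (counting [set x | P x] <= m%:R%:E :> \bar R)%E.
Proof.
move=> Pm; have [l [Pl lmin]] := @least_nat (le_card P) (ex_intro _ m Pm).
by rewrite (counting_least Pl lmin) lee_fin ler_nat lmin.
Qed.

(** Since [m] is the least common bound, [m - 1] fails for some index, and the supremum is attained
    there. *)
Lemma sup_counting_least (I : Type) (A : set I) (X : choiceType) (P : I -> X -> Prop) m :
  A !=set0 -> (forall a, A a -> le_card (P a) m) ->
  (forall m', (forall a, A a -> le_card (P a) m') -> (m <= m')%N) ->
  ereal_sup [set counting [set x | P a x] | a in A] = m%:R%:E :> \bar R.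
Proof.
move=> [a0 Aa0] Pm mmin; apply/eqP; rewrite eq_le; apply/andP; split.
  by apply: ge_ereal_sup => _ [a Aa <-]; apply: counting_le; apply: Pm.
have [a Aa na] : exists2 a, A a & forall l, le_card (P a) l -> (m <= l)%N.
  case: m Pm mmin => [|m] Pm mmin; first by exists a0.
  apply: contrapT => na; suff : (m.+1 <= m)%N by rewrite ltnn.
  apply: mmin => a Aa; apply: contrapT => nPa; apply: na; exists a => // l Pl.
  by rewrite ltnNge; apply/negP => lm; apply: nPa; apply: le_card_leq Pl.
by apply: ereal_sup_ubound; exists a => //; apply: counting_least => //; apply: Pm.
Qed.

(** Removing the head of the tuple gives the list of steps. All vertices of a walk belong to the
    graph as soon as its start does, because [adj] leads to vertices. *)
Lemma le_card_saw_tuple (T : choiceType) (G : graph T) a n m :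
  (forall x y, adj G x y -> vertices G y) -> vertices G a ->
  le_card (fun w : n.+1.-tuple T => self_avoiding_walk G w /\ thead w = a) m <->
  le_card (saw (fun x y => `[< adj G x y >]) a n) m.
Proof.
move=> adjV Va; split=> h.
  have inj (p : seq T) : size p = n -> size (a :: p) == n.+1 by move=> /= ->.
  move=> s us sP; have sz p : p \in s -> size p = n by move=> /sP[].
  (* The constant tuple is a default for lists of the wrong size, which do not occur in [s]. *)
  pose f p : n.+1.-tuple T := if (size (a :: p) == n.+1) =P true is ReflectT e then Tuple e else [tuple of nseq n.+1 a].
  have fE p : p \in s -> f p = a :: p :> seq T.
    by move=> ps; rewrite /f; case: eqP => //; rewrite /= sz // eqxx.
  rewrite -(size_map f); apply: h.
    rewrite map_inj_in_uniq // => p q ps qs fpq.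
    by have := congr1 val fpq; rewrite /= !fE // => -[].
  move=> _ /mapP[p ps ->]; have [sp ep up] := sP p ps; split; last first.
    by rewrite /thead (tnth_nth a) fE.
  split; last by rewrite fE.
  split; last by rewrite fE.
  move=> k; rewrite (tnth_nth a) fE //.
  have : nth a (a :: p) k \in a :: p by rewrite mem_nth //= sp.
  move: (nth _ _ _) => x; move: ep Va; clear -adjV; elim: p a => [|b p IH] a /=.
    by move=> _ Va; rewrite inE => /eqP ->.
  move=> /andP[/asboolP /adjV Vb ep] Va; rewrite inE => /orP[/eqP ->//|]; exact: IH ep Vb.
apply: (le_card_inj (f := fun w : n.+1.-tuple T => behead w) _ _ h).
  move=> w w' [_ wa] [_ wa'] bE; apply: val_inj => /=.
  by rewrite (tuple_eta w) (tuple_eta w') wa wa' /= bE.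
move=> w [[[_ ew] uw] wa]; rewrite /saw size_behead size_tuple.
by move: ew uw; rewrite {1 2}(tuple_eta w) wa /= => ew uw; split.
Qed.
End Counting.

Lemma cvg_poweR_root (R : realType) (a : nat -> nat) (f : nat -> \bar R) (mu : R) :
  (forall n, f n = (a n)%:R%:E) -> (fun n => (a n)%:R `^ n%:R^-1) @ \oo --> mu ->
  (fun n => poweR (f n) n%:R^-1) @ \oo --> mu%:E.
Proof.
move=> fE amu; have -> : (fun n => poweR (f n) n%:R^-1) = (fun n => ((a n)%:R `^ n%:R^-1)%:E).
  by apply/funext => n; rewrite fE poweR_EFin.
by apply: cvg_EFin => //; apply: nearW.
Qed.

Unset Implicit Arguments.

Theorem theorem1 (R : realType) (d M : nat) (hd : (1 <= d)%N) (hM : (2 <= M)%N)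
    (S : similitudes R d M) (K : set 'cV[R]_d)
    (hK : nested_fractal S K) (hS : one_point_intersection S)
    (O : 'cV[R]_d) (hO : V0 S O)
    (i0 : 'I_M) (hi0 : i0 = 0%N :> nat) (hfix : Psi S i0 O = O) :
  let c := saw_count R (Finfty S i0) O in
  let u := saw_sup R (Finfty S i0) in
  let D := max_degree R (Finfty S i0) in
  exists mu : R,
    [/\ (fun n => poweR (c n) n%:R^-1) @ \oo --> mu%:E,
        (fun n => poweR (u n) n%:R^-1) @ \oo --> mu%:E,
        mu%:E = ereal_inf [set poweR (u n) n%:R^-1 | n in [set n | (1 <= n)%N]]
      & [/\ 1 <= mu, (mu%:E <= D - 1%:E)%E & (D - 1%:E < +oo)%E]].
Proof.
move=> c u D.
pose G := Finfty S i0; pose e : rel 'cV[R]_d := einf S i0.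
have eV : forall x y, e x y -> vertices G y := @einf_vertices _ _ _ S i0.
have e_sym : symmetric e := einf_sym hK i0.
have VO : vertices G O := vertices_O i0 hO.
have adjV x y : adj G x y -> vertices G y by move=> /asboolP; apply: eV.
(* Least natural bounds for the degrees and the walk counts exist; they turn out to be the values of
   [D], [u] and [c], which are thus finite. *)
have [D1 [degD D_min]] : exists m, (forall x, vertices G x -> le_card (fun y => e x y) m) /\
    forall m', (forall x, vertices G x -> le_card (fun y => e x y) m') -> (m <= m')%N.
  exact: least_nat (degree_bound hK i0).
have /choice[u1 u1P] : forall n, exists m, (forall a, vertices G a -> le_card (saw e a n) m) /\
    forall m', (forall a, vertices G a -> le_card (saw e a n) m') -> (m <= m')%N.
  by move=> n; apply: least_nat; exists (D1 ^ n)%N; apply: le_card_saw_exp.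
have /choice[c1 c1P] : forall n, exists m, le_card (saw e O n) m /\
    forall m', le_card (saw e O n) m' -> (m <= m')%N.
  by move=> n; apply: least_nat; exists (u1 n); apply: (u1P n).1.
have cE n : c n = (c1 n)%:R%:E.
  have [h1 h2] := c1P n; apply: counting_least; first exact/(le_card_saw_tuple _ _ adjV VO).
  by move=> m' /(le_card_saw_tuple _ _ adjV VO); apply: h2.
have uE n : u n = (u1 n)%:R%:E.
  have [h1 h2] := u1P n; apply: sup_counting_least; first by exists O.
    by move=> a Va; apply/(le_card_saw_tuple _ _ adjV Va); apply: h1.
  by move=> m' h; apply: h2 => a Va; apply/(le_card_saw_tuple _ _ adjV Va); apply: h.
have DE : D = D1%:R%:E.
  apply: sup_counting_least; first by exists O.
    by move=> a Va; apply: le_card_sub (degD a Va) => y h; apply/asboolP.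
  by move=> m' h; apply: D_min => a Va; apply: le_card_sub (h a Va) => y /asboolP.
have hu a n Va := (u1P n).1 a Va; have u_min n m h := (u1P n).2 m h.
have hc n := (c1P n).1; have c_min n m h := (c1P n).2 m h.
have c_ge1 n : (0 < c1 n)%N.
  have [p sp] := saw_exists hK hO hfix n.
  by apply: (hc n [:: p]) => // q; rewrite inE => /eqP ->.
have [N [A charts]] := charts_exist hK hS hO hfix.
have [C hC] := sum_rho hK.
have scales E : exists s n0, forall n, (n0 <= n)%N ->
    exists2 k, separated e (kvert S i0) (k + s) n & (E * (A * \sum_(j < k.+1) rho hK j) <= n)%N.
  have AC k : (A * \sum_(j < k.+1) rho hK j <= A * C * rho hK k)%N.
    by rewrite -mulnA leq_mul2l hC orbT.
  have [s [n0 h]] := scales_exist AC E; exists s, n0 => n /h[k nk Ek]; exists k => //.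
  exact: (kvert_separated nk).
have u_gt0 := u_gt0 VO hu c_min c_ge1.
have cvg_c : (fun n => (c1 n)%:R `^ n%:R^-1) @ \oo --> growth_rate R u1.
  exact: (cvg_root_count e_sym eV VO hu u_min hc c_min c_ge1 degD charts scales
    (@kvert_visits _ _ _ _ _ hK i0)).
have u_mul := u_mul eV hu u_min.
exists (growth_rate R u1); split.
- exact: (cvg_poweR_root cE cvg_c).
- exact: (cvg_poweR_root uE (cvg_root_growth_rate u_mul u_gt0)).
- apply/eqP; rewrite eq_le; apply/andP; split.
    apply: le_ereal_inf_tmp => _ [n n1 <-].
    by rewrite uE poweR_EFin lee_fin; apply: growth_rate_le_root.
  (* The infimum is over extended reals, so it is compared with [growth_rate] through near-minimal
     roots. *)
  apply/lee_addgt0Pr => eps eps0.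
  have [n n0 h] := growth_rate_adherent u_gt0 eps0.
  apply: ge_ereal_inf; exists (poweR (u n) n%:R^-1); first by exists n.
  by rewrite uE poweR_EFin -EFinD lee_fin ltW.
- split; first exact: growth_rate_ge1.
  + rewrite DE -EFinB lee_fin.
    exact: (growth_rate_le_degree e_sym eV VO hu u_min c_min c_ge1 degD).
  + by rewrite DE -EFinB ltry.
Qed.
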